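(* Let $\mathfrak A,\mathfrak B,\mathfrak C$ be bicategories and $\mathbf F:\mathfrak A\to\mathfrak B$, $\mathbf G:\mathfrak B\to\mathfrak C$, $\mathbf H:\mathfrak A\to\mathfrak C$ pseudofunctors with a pseudonatural equivalence $\Gamma:\mathbf{GF}\Rightarrow\mathbf H$. Let $\mathbf L:\mathfrak B\to\mathfrak A$ be a left biadjoint of $\mathbf F$ with unit $\Phi:\mathbf 1_{\mathfrak B}\Rightarrow\mathbf{FL}$, and let $\mathbf N:\mathfrak C\to\mathfrak A$ be a left biadjoint of $\mathbf H$ with unit $\Psi$ and counit $\Upsilon$. Let $\Psi''$, $\Theta'$, $\Theta''$, $\Xi$, $\phi_1$, $\phi_2$ be the pseudonatural transformations and invertible modifications constructed from these data in the context. Assume: 1. there is a modification $\mu:\Phi_{\mathbf{FN}}\Rrightarrow\Xi$ admitting an inverter $(\mathbf M,\ \Lambda:\mathbf M\Rightarrow\mathbf{FN})$ in $\mathfrak B^{\mathfrak C}$; 2. $\mathbf G$ preserves this inverter, i.e. $(\mathbf{GM},\mathbf G(\Lambda))$ is an inverter of $\mathbf G(\mu)$; 3. $\mathbf G(\mu)*\Psi''$ is invertible; 4. $(\mathbf 1_{\mathfrak B},\Phi)$ is an inverter (in $\mathfrak B^{\mathfrak B}$) of a modification $\nu:\Phi_{\mathbf{FL}}\Rrightarrow\mathbf{FL}(\Phi)$ such that $$\phi_2\circ(\Theta''*\mu_{\mathbf G})=(\nu*\Theta')\circ\phi_1;$$ 5. $\mathbf G$ preserves the full faithfulness of $\Phi$,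 i.e. $\mathbf G(\Phi):\mathbf G\Rightarrow\mathbf G(\mathbf{FL})$ is fully faithful; 6. $\Phi_{\mathbf{FN}}$ is also fully faithful. Then $\mathbf M$ is a left biadjoint of $\mathbf G$.
   Context: **Conventions.** Bicategories and pseudofunctors are in the general weak sense. $\circ$ denotes composition of 1-morphisms and also vertical composition of 2-morphisms; $*$ is horizontal composition, a 1-morphism in a $*$-expression standing for its identity 2-morphism. $\mathfrak B^{\mathfrak A}$ is the bicategory of pseudofunctors $\mathfrak A\to\mathfrak B$, pseudonatural transformations ($\Rightarrow$) and modifications ($\Rrightarrow$). A pseudonatural transformation $\Phi:\mathbf F\Rightarrow\mathbf G$ has components $\Phi_X$ and invertible 2-cells $\Phi_f:\mathbf G(f)\circ\Phi_X\Rightarrow\Phi_Y\circ\mathbf F(f)$. Composition of pseudofunctors is written $\mathbf{GF}$; $\mathrm A_{\mathbf H,\mathbf G,\mathbf F}:(\mathbf{HG})\mathbf F\Rightarrow\mathbf H(\mathbf{GF})$ is the associator, a pseudonatural equivalence with canonical quasi-inverse $\mathrm A^{-1}_{\mathbf H,\mathbf G,\mathbf F}$, pseudonatural in each variable and satisfying the pentagon up to a canonical invertible modification (the pentagonator). Whiskerings: $\Psi_{\mathbf F}$ has components $\Psi_{\mathbf F(X)}$, and $\mathbf G\Phi=\mathbf G(\Phi)$ has components $\mathbf G(\Phi_X)$; similarly $\mu_{\mathbf G}$ and $\mathbf G(\mu)$ for modifications. Unitors for composition with identity pseudofunctors are suppressed: for $\Psi:\mathbf G\Rightarrow\mathbf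 1$, $\Psi_{\mathbf F}$ means the transformation $\mathbf{GF}\Rightarrow\mathbf F$, and for $\Phi:\mathbf 1\Rightarrow\mathbf F$, $\mathbf G(\Phi)$ means $\mathbf G\Rightarrow\mathbf{GF}$, etc. Exchange: for $\Phi:\mathbf F_1\Rightarrow\mathbf F_2$ and $\Psi:\mathbf G_1\Rightarrow\mathbf G_2$ horizontally composable, $\Psi_\Phi:\mathbf G_2(\Phi)\circ\Psi_{\mathbf F_1}\Rrightarrow\Psi_{\mathbf F_2}\circ\mathbf G_1(\Phi)$ is the invertible modification with components $\Psi_{\Phi_X}$. **Biadjunction** $\mathbf L\dashv\mathbf R$ ($\mathbf L:\mathfrak A\to\mathfrak B$, $\mathbf R:\mathfrak B\to\mathfrak A$): pseudonatural transformations $\mathrm H:\mathbf 1_{\mathfrak A}\Rightarrow\mathbf{RL}$ (unit), $\mathrm E:\mathbf{LR}\Rightarrow\mathbf 1_{\mathfrak B}$ (counit) and invertible modifications $\mathrm E_{\mathbf L}\circ\mathrm A^{-1}_{\mathbf L,\mathbf R,\mathbf L}\circ\mathbf L(\mathrm H)\Rrightarrow 1_{\mathbf L}$ (left triangle) and $\mathbf R(\mathrm E)\circ\mathrm A_{\mathbf R,\mathbf L,\mathbf R}\circ\mathrm H_{\mathbf R}\Rrightarrow 1_{\mathbf R}$ (right triangle); no further coherence is required. Then $\mathbf L$ is a left biadjoint of $\mathbf R$. **Inverters.** Let $\phi:f_1\Rightarrow f_2$ be a 2-morphism between $f_1,f_2:X_1\to X_2$ in a bicategory $\mathfrak D$.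 An inverter cone is a pair $(X_0,f_0:X_0\to X_1)$ with $\phi*f_0$ invertible. For fixed $X_0$ these form a full subcategory $\mathbf{InvCone}(X_0;\phi)\subseteq\mathbf{Hom}_{\mathfrak D}(X_0,X_1)$. An inverter of $\phi$ is an inverter cone $(\tilde X_0,\tilde f_0)$ such that for every $X_0$, $\tilde f_0\circ-$ induces an equivalence $\mathbf{Hom}_{\mathfrak D}(X_0,\tilde X_0)\to\mathbf{InvCone}(X_0;\phi)$. **Fully faithful 1-morphism** $f:X\to X'$ of $\mathfrak D$: for every object $Y$, the functor $f\circ-:\mathbf{Hom}_{\mathfrak D}(Y,X)\to\mathbf{Hom}_{\mathfrak D}(Y,X')$ is fully faithful. For pseudonatural transformations this is meant in the appropriate bicategory of pseudofunctors. **Constructed transformations** ($\Gamma^{-1}$ a quasi-inverse of $\Gamma$): - $\Psi'=\Gamma^{-1}_{\mathbf N}\circ\Psi:\mathbf 1_{\mathfrak C}\Rightarrow(\mathbf{GF})\mathbf N$ and $\Upsilon'=\Upsilon\circ\mathbf N\Gamma:\mathbf N(\mathbf{GF})\Rightarrow\mathbf 1_{\mathfrak A}$, which are unit and counit of a biadjunction $\mathbf N\dashv\mathbf{GF}$, the triangle modifications being transported from those of $\mathbf N\dashv\mathbf H$ along $\Gamma$ (e.g. the right one at $a$ is $\mathbf{GF}(\Upsilon_a)\circ\mathbf{GFN}(\Gamma_a)\circ\Gamma^{-1}_{\mathbf{NGF}a}\circ\Psi_{\mathbf{GF}a}\cong\Gamma_a^{-1}\circ\mathbf H(\Upsilon_a)\circ\mathbf{HN}(\Gamma_a)\circ\Psi_{\mathbf{GF}a}\cong\Gamma_a^{-1}\circ\mathbf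 H(\Upsilon_a)\circ\Psi_{\mathbf Ha}\circ\Gamma_a\cong\Gamma_a^{-1}\circ\Gamma_a\cong1$). - $\Phi'=\mathrm A^{-1}_{\mathbf G,\mathbf F,\mathbf L}\circ\mathbf G\Phi:\mathbf G\Rightarrow(\mathbf{GF})\mathbf L$. - $\Theta=\Upsilon'_{\mathbf L}\circ\mathrm A^{-1}_{\mathbf N,\mathbf{GF},\mathbf L}\circ\mathbf N(\Phi'):\mathbf{NG}\Rightarrow\mathbf L$. - $\Theta'=\mathbf F\Theta\circ\mathrm A_{\mathbf F,\mathbf N,\mathbf G}:(\mathbf{FN})\mathbf G\Rightarrow\mathbf{FL}$. - $\Psi''=\mathrm A_{\mathbf G,\mathbf F,\mathbf N}\circ\Psi':\mathbf 1_{\mathfrak C}\Rightarrow\mathbf G(\mathbf{FN})$. - $\Xi'=\mathrm A^{-1}_{\mathbf{FN},\mathbf G,\mathbf{FN}}\circ(\mathbf{FN})(\Psi''):\mathbf{FN}\Rightarrow((\mathbf{FN})\mathbf G)(\mathbf{FN})$ and $\Xi=\Theta'_{\mathbf{FN}}\circ\Xi':\mathbf{FN}\Rightarrow(\mathbf{FL})(\mathbf{FN})$. - $\Theta''=(\mathbf{FL})(\Theta')\circ\mathrm A_{\mathbf{FL},\mathbf{FN},\mathbf G}:((\mathbf{FL})(\mathbf{FN}))\mathbf G\Rightarrow(\mathbf{FL})(\mathbf{FL})$. **The invertible modifications $\phi_1,\phi_2$** (associators and unitors of the bicategories of pseudofunctors suppressed). $\phi_1:\Theta''\circ(\Phi_{\mathbf{FN}})_{\mathbf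 G}\Rrightarrow\Phi_{\mathbf{FL}}\circ\Theta'$ is the composite $(\mathbf{FL})(\Theta')\circ\mathrm A_{\mathbf{FL},\mathbf{FN},\mathbf G}\circ(\Phi_{\mathbf{FN}})_{\mathbf G}\cong(\mathbf{FL})(\Theta')\circ\Phi_{(\mathbf{FN})\mathbf G}\cong\Phi_{\mathbf{FL}}\circ\Theta'$, using pseudonaturality of $\mathrm A$ in $\Phi$ and then the exchange $\Phi_{\Theta'}$. $\phi_2:\Theta''\circ\Xi_{\mathbf G}\Rrightarrow\mathbf{FL}(\Phi)\circ\Theta'$ is the composite $(\mathbf{FL})(\Theta')\circ\mathrm A_{\mathbf{FL},\mathbf{FN},\mathbf G}\circ(\Theta'_{\mathbf{FN}})_{\mathbf G}\circ\Xi'_{\mathbf G}\cong(\mathbf{FL})(\Theta')\circ\Theta'_{(\mathbf{FN})\mathbf G}\circ\mathrm A_{(\mathbf{FN})\mathbf G,\mathbf{FN},\mathbf G}\circ\Xi'_{\mathbf G}\cong\Theta'_{\mathbf{FL}}\circ((\mathbf{FN})\mathbf G)\Theta'\circ\mathrm A_{(\mathbf{FN})\mathbf G,\mathbf{FN},\mathbf G}\circ\Xi'_{\mathbf G}\cong\Theta'_{\mathbf{FL}}\circ((\mathbf{FN})\mathbf G)\Phi\cong(\mathbf{FL})\Phi\circ\Theta'$, using successively pseudonaturality of $\mathrm A$, the exchange $\Theta'_{\Theta'}$, the modification (a) below, and the inverse exchange $(\Theta'_\Phi)^{-1}$. (a) $((\mathbf{FN})\mathbf G)\Theta'\circ\mathrm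 A_{(\mathbf{FN})\mathbf G,\mathbf{FN},\mathbf G}\circ\Xi'_{\mathbf G}\cong\mathrm A^{-1}_{\mathbf{FN},\mathbf G,\mathbf{FL}}\circ(\mathbf{FN})(\mathbf G\Theta'\circ\mathrm A_{\mathbf G,\mathbf{FN},\mathbf G}\circ\Psi''_{\mathbf G})\cong\mathrm A^{-1}_{\mathbf{FN},\mathbf G,\mathbf{FL}}\circ(\mathbf{FN})(\mathbf G\Phi)\cong((\mathbf{FN})\mathbf G)\Phi$. The first step uses $((\mathbf{FN})\Psi'')_{\mathbf G}\cong\mathrm A^{-1}_{\mathbf{FN},\mathbf G(\mathbf{FN}),\mathbf G}\circ(\mathbf{FN})(\Psi''_{\mathbf G})$, a pentagonator, and pseudonaturality of $\mathrm A^{-1}$ in $\Theta'$; the second is $(\mathbf{FN})(\phi_2'')$; the third is pseudonaturality of $\mathrm A^{-1}$ in $\Phi$. $\phi_2'':\mathbf G\Theta'\circ\mathrm A_{\mathbf G,\mathbf{FN},\mathbf G}\circ\Psi''_{\mathbf G}\Rrightarrow\mathbf G\Phi$ is the composite: expand $\Psi''$ and $\Theta'$ and use a pentagonator and pseudonaturality of $\mathrm A$ to get $\mathrm A_{\mathbf G,\mathbf F,\mathbf L}\circ(\mathbf{GF})\Theta\circ\mathrm A_{\mathbf{GF},\mathbf N,\mathbf G}\circ\Psi'_{\mathbf G}$; expand $\Theta$ and use pseudonaturality of $\mathrm A$ in $\Phi'$ and the exchange $\Psi'_{\Phi'}$ to get $\mathrm A_{\mathbf G,\mathbf F,\mathbf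 L}\circ(\mathbf{GF})(\Upsilon'_{\mathbf L})\circ(\mathbf{GF})(\mathrm A^{-1}_{\mathbf N,\mathbf{GF},\mathbf L})\circ\mathrm A_{\mathbf{GF},\mathbf N,(\mathbf{GF})\mathbf L}\circ\Psi'_{(\mathbf{GF})\mathbf L}\circ\Phi'$; by a pentagonator and pseudonaturality of associators this is isomorphic to $\mathrm A_{\mathbf G,\mathbf F,\mathbf L}\circ\big((\mathbf{GF})\Upsilon'\circ\mathrm A_{\mathbf{GF},\mathbf N,\mathbf{GF}}\circ\Psi'_{\mathbf{GF}}\big)_{\mathbf L}\circ\Phi'$; the right triangle modification of $\mathbf N\dashv\mathbf{GF}$ reduces it to $\mathrm A_{\mathbf G,\mathbf F,\mathbf L}\circ\Phi'\cong\mathbf G\Phi$. *)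

(* Defs.v *)
From Stdlib Require Import FunctionalExtensionality ProofIrrelevance.
From Stdlib Require Import ssreflect.

Set Implicit Arguments.
Unset Strict Implicit.
Unset Printing Implicit Defensive.
Set Bullet Behavior "Strict Subproofs".

(* Bicategories presented by whiskerings: [lwh g a] is g * a, [rwh b f] is
   b * f, and composition of 1-cells and of 2-cells is in applicative order. *)
Record Bicat := mkBicat {
  Ob :> Type;
  Hom : Ob -> Ob -> Type;
  Cell : forall {x y : Ob}, Hom x y -> Hom x y -> Type;
  id1 : forall x, Hom x x;
  comp1 : forall {x y z}, Hom y z -> Hom x y -> Hom x z;
  id2 : forall {x y} (f : Hom x y), Cell f f;
  vcomp : forall {x y} {f g h : Hom x y}, Cell g h -> Cell f g -> Cell f h;
  lwh : forall {x y z} (g : Hom y z) {f f' : Hom x y},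
    Cell f f' -> Cell (comp1 g f) (comp1 g f');
  rwh : forall {x y z} {g g' : Hom y z},
    Cell g g' -> forall f : Hom x y, Cell (comp1 g f) (comp1 g' f);
  lun : forall {x y} (f : Hom x y), Cell (comp1 (id1 y) f) f;
  luni : forall {x y} (f : Hom x y), Cell f (comp1 (id1 y) f);
  run : forall {x y} (f : Hom x y), Cell (comp1 f (id1 x)) f;
  runi : forall {x y} (f : Hom x y), Cell f (comp1 f (id1 x));
  asc : forall {w x y z} (h : Hom y z) (g : Hom x y) (f : Hom w x),
    Cell (comp1 (comp1 h g) f) (comp1 h (comp1 g f));
  asci : forall {w x y z} (h : Hom y z) (g : Hom x y) (f : Hom w x),
    Cell (comp1 h (comp1 g f)) (comp1 (comp1 h g) f);
  vidl : forall x y (f g : Hom x y) (a : Cell f g), vcomp (id2 g) a = a;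
  vidr : forall x y (f g : Hom x y) (a : Cell f g), vcomp a (id2 f) = a;
  vassoc : forall x y (f g h k : Hom x y)
    (c : Cell h k) (b : Cell g h) (a : Cell f g),
    vcomp (vcomp c b) a = vcomp c (vcomp b a);
  lwh_id : forall x y z (g : Hom y z) (f : Hom x y),
    lwh g (id2 f) = id2 (comp1 g f);
  rwh_id : forall x y z (g : Hom y z) (f : Hom x y),
    rwh (id2 g) f = id2 (comp1 g f);
  lwh_comp : forall x y z (g : Hom y z) (f1 f2 f3 : Hom x y)
    (b : Cell f2 f3) (a : Cell f1 f2),
    lwh g (vcomp b a) = vcomp (lwh g b) (lwh g a);
  rwh_comp : forall x y z (g1 g2 g3 : Hom y z) (f : Hom x y)
    (b : Cell g2 g3) (a : Cell g1 g2),
    rwh (vcomp b a) f = vcomp (rwh b f) (rwh a f);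
  interchange : forall x y z (g g' : Hom y z) (f f' : Hom x y)
    (b : Cell g g') (a : Cell f f'),
    vcomp (rwh b f') (lwh g a) = vcomp (lwh g' a) (rwh b f);
  lun_nat : forall x y (f f' : Hom x y) (a : Cell f f'),
    vcomp (lun f') (lwh (id1 y) a) = vcomp a (lun f);
  run_nat : forall x y (f f' : Hom x y) (a : Cell f f'),
    vcomp (run f') (rwh a (id1 x)) = vcomp a (run f);
  asc_nat_l : forall w x y z (h h' : Hom y z) (c : Cell h h')
    (g : Hom x y) (f : Hom w x),
    vcomp (asc h' g f) (rwh (rwh c g) f) =
    vcomp (rwh c (comp1 g f)) (asc h g f);
  asc_nat_m : forall w x y z (h : Hom y z) (g g' : Hom x y)
    (b : Cell g g') (f : Hom w x),
    vcomp (asc h g' f) (rwh (lwh h b) f) =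
    vcomp (lwh h (rwh b f)) (asc h g f);
  asc_nat_r : forall w x y z (h : Hom y z) (g : Hom x y) (f f' : Hom w x)
    (a : Cell f f'),
    vcomp (asc h g f') (lwh (comp1 h g) a) =
    vcomp (lwh h (lwh g a)) (asc h g f);
  lun_luni : forall x y (f : Hom x y), vcomp (lun f) (luni f) = id2 f;
  luni_lun : forall x y (f : Hom x y), vcomp (luni f) (lun f) = id2 _;
  run_runi : forall x y (f : Hom x y), vcomp (run f) (runi f) = id2 f;
  runi_run : forall x y (f : Hom x y), vcomp (runi f) (run f) = id2 _;
  asc_asci : forall w x y z (h : Hom y z) (g : Hom x y) (f : Hom w x),
    vcomp (asc h g f) (asci h g f) = id2 _;
  asci_asc : forall w x y z (h : Hom y z) (g : Hom x y) (f : Hom w x),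
    vcomp (asci h g f) (asc h g f) = id2 _;
  triangle : forall x y z (g : Hom y z) (f : Hom x y),
    vcomp (lwh g (lun f)) (asc g (id1 y) f) = rwh (run g) f;
  pentagon : forall v w x y z (k : Hom y z) (h : Hom x y) (g : Hom w x)
    (f : Hom v w),
    vcomp (lwh k (asc h g f)) (vcomp (asc k (comp1 h g) f) (rwh (asc k h g) f))
    = vcomp (asc k h (comp1 g f)) (asc (comp1 k h) g f)
}.

Arguments id1 {_} _.

Notation "g ∘ f" := (comp1 g f) (at level 40, left associativity).
Notation "b • a" := (vcomp b a) (at level 45, right associativity).
Notation "g ◁ a" := (lwh g a) (at level 38, right associativity).
Notation "b ▷ f" := (rwh b f) (at level 36, left associativity).

Record iso2 {D : Bicat} {x y : D} (f g : Hom x y) := Iso2 {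
  fwd :> Cell f g;
  bwd : Cell g f;
  bwd_fwd : bwd • fwd = id2 f;
  fwd_bwd : fwd • bwd = id2 g
}.

Notation "f ≅ g" := (iso2 f g) (at level 70).

Definition invertible {D : Bicat} {x y : D} {f g : Hom x y} (a : Cell f g) :=
  exists b : Cell g f, b • a = id2 f /\ a • b = id2 g.

Section Isos.
Context {D : Bicat}.
Implicit Types x y z : D.

Lemma bwd_fwd_k x y (f g k : Hom x y) (i : f ≅ g) (a : Cell k f) :
  bwd i • fwd i • a = a.
Proof. by rewrite -vassoc bwd_fwd vidl. Qed.

Lemma fwd_bwd_k x y (f g k : Hom x y) (i : f ≅ g) (a : Cell k g) :
  fwd i • bwd i • a = a.
Proof. by rewrite -vassoc fwd_bwd vidl. Qed.

Lemma iso_monic x y (f g k : Hom x y) (i : f ≅ g) (a b : Cell k f) :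
  fwd i • a = fwd i • b -> a = b.
Proof. by move=> e; rewrite -(bwd_fwd_k i a) e bwd_fwd_k. Qed.

Lemma iso_epic x y (f g k : Hom x y) (i : f ≅ g) (a b : Cell g k) :
  a • fwd i = b • fwd i -> a = b.
Proof.
by move=> e; rewrite -(vidr a) -(vidr b) -(fwd_bwd i) -!vassoc e.
Qed.

Lemma vk x y (f g h k : Hom x y) (b : Cell g h) (a : Cell f g) c :
  b • a = c -> forall u : Cell k f, b • a • u = c • u.
Proof. by move=> <- u; rewrite vassoc. Qed.

Lemma move_bwd_l x y (f g k : Hom x y) (i : f ≅ g) (a : Cell k f) b :
  fwd i • a = b -> a = bwd i • b.
Proof. by move=> <-; rewrite bwd_fwd_k. Qed.

Lemma move_bwd_r x y (f g k : Hom x y) (i : f ≅ g) (a : Cell g k) b :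
  a • fwd i = b -> a = b • bwd i.
Proof. by move=> <-; rewrite vassoc fwd_bwd vidr. Qed.

Definition iso_refl x y (f : Hom x y) : f ≅ f :=
  Iso2 (vidl (id2 f)) (vidl (id2 f)).

Definition iso_sym x y (f g : Hom x y) (i : f ≅ g) : g ≅ f :=
  Iso2 (fwd_bwd i) (bwd_fwd i).

Definition iso_trans x y (f g h : Hom x y) (i : f ≅ g) (j : g ≅ h) : f ≅ h.
Proof.
refine (@Iso2 D x y f h (fwd j • fwd i) (bwd i • bwd j) _ _).
- by rewrite vassoc bwd_fwd_k bwd_fwd.
- by rewrite vassoc fwd_bwd_k fwd_bwd.
Defined.

Definition iso_lwh x y z (g : Hom y z) (f f' : Hom x y) (i : f ≅ f') :
  g ∘ f ≅ g ∘ f'.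
Proof.
refine (@Iso2 D _ _ _ _ (g ◁ fwd i) (g ◁ bwd i) _ _).
- by rewrite -lwh_comp bwd_fwd lwh_id.
- by rewrite -lwh_comp fwd_bwd lwh_id.
Defined.

Definition iso_rwh x y z (g g' : Hom y z) (i : g ≅ g') (f : Hom x y) :
  g ∘ f ≅ g' ∘ f.
Proof.
refine (@Iso2 D _ _ _ _ (fwd i ▷ f) (bwd i ▷ f) _ _).
- by rewrite -rwh_comp bwd_fwd rwh_id.
- by rewrite -rwh_comp fwd_bwd rwh_id.
Defined.

Definition iso_lun x y (f : Hom x y) : id1 y ∘ f ≅ f :=
  Iso2 (luni_lun f) (lun_luni f).
Definition iso_run x y (f : Hom x y) : f ∘ id1 x ≅ f :=
  Iso2 (runi_run f) (run_runi f).
Definition iso_asc w x y z (h : Hom y z) (g : Hom x y) (f : Hom w x) :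
  (h ∘ g) ∘ f ≅ h ∘ (g ∘ f) :=
  Iso2 (asci_asc h g f) (asc_asci h g f).

Lemma lwh_id1_inj x y (f g : Hom x y) (a b : Cell f g) :
  id1 y ◁ a = id1 y ◁ b -> a = b.
Proof.
move=> e; apply: (iso_epic (i := iso_lun f)); rewrite /= -!lun_nat.
by rewrite e.
Qed.

Lemma rwh_id1_inj x y (f g : Hom x y) (a b : Cell f g) :
  a ▷ id1 x = b ▷ id1 x -> a = b.
Proof.
move=> e; apply: (iso_epic (i := iso_run f)); rewrite /= -!run_nat.
by rewrite e.
Qed.

Lemma lun_comp x y z (g : Hom y z) (f : Hom x y) :
  lun (g ∘ f) • asc (id1 z) g f = lun g ▷ f.
Proof.
apply: lwh_id1_inj.
apply: (iso_epic (i := iso_trans (iso_rwh (iso_asc (id1 z) (id1 z) g) f)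
  (iso_asc (id1 z) (id1 z ∘ g) f))).
rewrite /= lwh_comp vassoc pentagon -vassoc triangle -asc_nat_l -triangle.
by rewrite rwh_comp -vassoc asc_nat_m vassoc.
Qed.

End Isos.

(* Every 1-cell expression t : x -> y acts on the 1-cells h : w -> x by nested
composition, and a 2-cell between expressions acts accordingly; under this
(faithful) action the structural 2-cells become identities.  This
section and its tactics only serve to prove coherence equations. *)

Section Strict.
Context {D : Bicat}.

Inductive Hexp : D -> D -> Type :=
| tv x y (f : Hom x y) : Hexp x y
| t1 x : Hexp x x
| tc x y z (g : Hexp y z) (f : Hexp x y) : Hexp x z.

Fixpoint eval x y (t : Hexp x y) : Hom x y :=
  match t with
  | tv f => f
  | t1 x => id1 x
  | tc g f => eval g ∘ eval f
  end.

Fixpoint act x y (t : Hexp x y) w : Hom w x -> Hom w y :=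
  match t in Hexp x y return Hom w x -> Hom w y with
  | tv f => fun h => f ∘ h
  | t1 x => fun h => h
  | tc g f => fun h => act g (act f h)
  end.

Fixpoint act2 x y (t : Hexp x y) w :
  forall h h' : Hom w x, Cell h h' -> Cell (act t h) (act t h') :=
  match t in Hexp x y return
    forall h h' : Hom w x, Cell h h' -> Cell (act t h) (act t h') with
  | tv f => fun h h' c => f ◁ c
  | t1 x => fun h h' c => c
  | tc g f => fun h h' c => act2 g (act2 f c)
  end.

Lemma act2_id x y (t : Hexp x y) w (h : Hom w x) :
  act2 t (id2 h) = id2 (act t h).
Proof.
elim: t w h => [*|*|??? g IHg f IHf w h] /=.
- by rewrite lwh_id.
- by [].
- by rewrite IHf IHg.
Qed.

Lemma act2_comp x y (t : Hexp x y) w (h h' h'' : Hom w x)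
  (b : Cell h' h'') (a : Cell h h') :
  act2 t (b • a) = act2 t b • act2 t a.
Proof.
elim: t w h h' h'' b a => [*|*|??? g IHg f IHf *] /=.
- by rewrite lwh_comp.
- by [].
- by rewrite IHf IHg.
Qed.

Definition act2_iso x y (t : Hexp x y) w (h h' : Hom w x) (i : h ≅ h') :
  act t h ≅ act t h'.
Proof.
refine (@Iso2 D _ _ _ _ (act2 t (fwd i)) (act2 t (bwd i)) _ _).
- by rewrite -act2_comp bwd_fwd act2_id.
- by rewrite -act2_comp fwd_bwd act2_id.
Defined.

Fixpoint theta x y (t : Hexp x y) w : forall h : Hom w x, eval t ∘ h ≅ act t h :=
  match t in Hexp x y return forall h : Hom w x, eval t ∘ h ≅ act t h with
  | tv f => fun h => iso_refl (f ∘ h)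
  | t1 x => fun h => iso_lun h
  | tc g f => fun h =>
      iso_trans (iso_asc (eval g) (eval f) h)
        (iso_trans (theta g (eval f ∘ h)) (act2_iso g (theta f h)))
  end.

Lemma theta_nat x y (t : Hexp x y) w (h h' : Hom w x) (c : Cell h h') :
  theta t h' • (eval t ◁ c) = act2 t c • theta t h.
Proof.
elim: t w h h' c => [*|*|??? g IHg f IHf w h h' c] /=.
- by rewrite vidl vidr.
- by rewrite lun_nat.
- rewrite vassoc asc_nat_r -!vassoc; congr (_ • _).
  rewrite vassoc IHg -!vassoc -act2_comp IHf.
  by rewrite act2_comp vassoc.
Qed.

Fact gen_key : {g : forall x y (s t : Hexp x y), Cell (eval s) (eval t) ->
    forall w (h : Hom w x), Cell (act s h) (act t h) |
  forall x y (s t : Hexp x y) (a : Cell (eval s) (eval t)) w (h : Hom w x),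
    g x y s t a w h = fwd (theta t h) • (a ▷ h) • bwd (theta s h)}.
Proof. by exists (fun x y s t a w h => fwd (theta t h) • (a ▷ h) • bwd (theta s h)). Qed.

Definition gen : forall x y (s t : Hexp x y), Cell (eval s) (eval t) ->
    forall w (h : Hom w x), Cell (act s h) (act t h) := proj1_sig gen_key.
Definition genE : forall x y (s t : Hexp x y) (a : Cell (eval s) (eval t)) w
  (h : Hom w x), gen a h = fwd (theta t h) • (a ▷ h) • bwd (theta s h)
  := proj2_sig gen_key.

Inductive Cexp : forall x y, Hexp x y -> Hexp x y -> Type :=
| cv x y (s t : Hexp x y) (a : Cell (eval s) (eval t)) : Cexp s t
| ci x y (t : Hexp x y) : Cexp t t
| cc x y (r s t : Hexp x y) : Cexp s t -> Cexp r s -> Cexp r t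
| cl x y z (g : Hexp y z) (s t : Hexp x y) : Cexp s t -> Cexp (tc g s) (tc g t)
| cr x y z (s t : Hexp y z) : Cexp s t -> forall f : Hexp x y, Cexp (tc s f) (tc t f)
| clun x y (f : Hexp x y) : Cexp (tc (t1 y) f) f
| cluni x y (f : Hexp x y) : Cexp f (tc (t1 y) f)
| crun x y (f : Hexp x y) : Cexp (tc f (t1 x)) f
| cruni x y (f : Hexp x y) : Cexp f (tc f (t1 x))
| casc w x y z (h : Hexp y z) (g : Hexp x y) (f : Hexp w x) :
    Cexp (tc (tc h g) f) (tc h (tc g f))
| casci w x y z (h : Hexp y z) (g : Hexp x y) (f : Hexp w x) :
    Cexp (tc h (tc g f)) (tc (tc h g) f).

Fixpoint evalc x y (s t : Hexp x y) (c : Cexp s t) : Cell (eval s) (eval t) :=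
  match c in @Cexp x y s t return Cell (eval s) (eval t) with
  | cv a => a
  | ci t => id2 (eval t)
  | cc d c => evalc d • evalc c
  | cl g c => eval g ◁ evalc c
  | cr c f => evalc c ▷ eval f
  | clun f => lun (eval f)
  | cluni f => luni (eval f)
  | crun f => run (eval f)
  | cruni f => runi (eval f)
  | casc h g f => asc (eval h) (eval g) (eval f)
  | casci h g f => asci (eval h) (eval g) (eval f)
  end.

Fixpoint actc x y (s t : Hexp x y) (c : Cexp s t) w :
  forall h : Hom w x, Cell (act s h) (act t h) :=
  match c in @Cexp x y s t return forall h : Hom w x, Cell (act s h) (act t h) with
  | cv a => fun h => gen a h
  | ci t => fun h => id2 _
  | cc d c => fun h => actc d h • actc c h
  | cl g c => fun h => act2 g (actc c h)
  | cr c f => fun h => actc c (act f h)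
  | clun f => fun h => id2 _
  | cluni f => fun h => id2 _
  | crun f => fun h => id2 _
  | cruni f => fun h => id2 _
  | casc _ g f => fun h => id2 _
  | casci _ g f => fun h => id2 _
  end.

Lemma actcE x y (s t : Hexp x y) (c : Cexp s t) w (h : Hom w x) :
  fwd (theta t h) • (evalc c ▷ h) = actc c h • theta s h.
Proof.
elim: c w h => {x y s t}.
- move=> x y s t a w h; rewrite /= genE.
  by rewrite !vassoc bwd_fwd vidr.
- by move=> x y t w h; rewrite /= rwh_id vidl vidr.
- move=> x y r s t d IHd c IHc w h /=.
  by rewrite rwh_comp -vassoc IHd vassoc IHc vassoc.
- move=> x y z g s t c IHc w h /=.
  rewrite !vassoc asc_nat_m -2!vassoc (vassoc _ (fwd (theta g _))) theta_nat.
  rewrite -!vassoc -!act2_comp IHc.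
  by rewrite !vassoc.
- move=> x y z s t c IHc f w h /=.
  rewrite !vassoc asc_nat_l -(vassoc (fwd (theta t _))) IHc.
  have N : forall (k k' : Hom w y) (i : Cell k k'),
      act2 t i • actc c k = actc c k' • act2 s i.
    move=> k k' i; apply: (iso_epic (i := theta s k)).
    rewrite vassoc -IHc vassoc -theta_nat -!vassoc -IHc -theta_nat !vassoc.
    by rewrite -interchange.
  by rewrite -!vassoc N.
- move=> x y f w h /=.
  by rewrite vidl !vassoc lun_comp.
- move=> x y f w h /=.
  rewrite vidl !vassoc -(vassoc (lun _)) lun_comp -rwh_comp.
  by rewrite lun_luni rwh_id vidr.
- move=> x y f w h /=.
  rewrite vidl -theta_nat !vassoc.
  by rewrite triangle.
- move=> x y f w h /=.
  rewrite vidl -theta_nat !vassoc.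
  by rewrite -(vassoc (_ ◁ _)) triangle -rwh_comp run_runi rwh_id vidr.
- move=> v w x y h g f u k /=.
  rewrite vidl !act2_comp !vassoc.
  rewrite -(vassoc (act2 h (asc _ _ _))) -theta_nat !vassoc.
  by rewrite pentagon.
- move=> v w x y h g f u k /=.
  rewrite vidl !act2_comp !vassoc.
  apply: (iso_epic (i := iso_rwh (iso_asc (eval h) (eval g) (eval f)) k)) => /=.
  rewrite !vassoc -rwh_comp asci_asc rwh_id vidr.
  rewrite -(vassoc (act2 h (asc _ _ _))) -theta_nat !vassoc.
  by rewrite pentagon.
Qed.

Lemma actcP x y (s t : Hexp x y) (c d : Cexp s t) :
  (forall w (h : Hom w x), actc c h = actc d h) -> evalc c = evalc d.
Proof.
move=> e; apply: rwh_id1_inj; apply: (iso_monic (i := theta t (id1 x))).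
by rewrite !actcE e.
Qed.

Lemma actcI x y (s t : Hexp x y) (c d : Cexp s t) :
  evalc c = evalc d -> forall w (h : Hom w x), actc c h = actc d h.
Proof.
move=> e w h; apply: (iso_epic (i := theta s h)).
by rewrite -!actcE e.
Qed.

Lemma gen_nat x y (s t : Hexp x y) (a : Cell (eval s) (eval t)) w
  (h h' : Hom w x) (c : Cell h h') :
  gen a h' • act2 s c = act2 t c • gen a h.
Proof.
rewrite !genE; apply: (iso_epic (i := theta s h)).
rewrite !vassoc bwd_fwd -theta_nat bwd_fwd_k vidr -(vassoc (act2 t c)) -theta_nat.
by rewrite !vassoc interchange.
Qed.

Lemma gen_comp x y (r s t : Hexp x y) (b : Cell (eval s) (eval t))
  (a : Cell (eval r) (eval s)) w (h : Hom w x) :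
  gen (s := r) (t := t) (b • a) h = gen b h • gen a h.
Proof. by rewrite !genE rwh_comp !vassoc bwd_fwd_k. Qed.

Lemma gen_id x y (t : Hexp x y) w (h : Hom w x) :
  gen (s := t) (t := t) (id2 (eval t)) h = id2 (act t h).
Proof. by rewrite !genE rwh_id vidl fwd_bwd. Qed.

Lemma gen_bf x y (s t : Hexp x y) (i : eval s ≅ eval t) w (h : Hom w x) :
  gen (bwd i) h • gen (fwd i) h = id2 _.
Proof. by rewrite -gen_comp bwd_fwd gen_id. Qed.

Lemma gen_fb x y (s t : Hexp x y) (i : eval s ≅ eval t) w (h : Hom w x) :
  gen (fwd i) h • gen (bwd i) h = id2 _.
Proof. by rewrite -gen_comp fwd_bwd gen_id. Qed.

Lemma gen_bf_k x y (s t : Hexp x y) (i : eval s ≅ eval t) w (h : Hom w x) k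
  (c : Cell k (act s h)) : gen (bwd i) h • gen (fwd i) h • c = c.
Proof. by rewrite -vassoc gen_bf vidl. Qed.

Lemma gen_fb_k x y (s t : Hexp x y) (i : eval s ≅ eval t) w (h : Hom w x) k
  (c : Cell k (act t h)) : gen (fwd i) h • gen (bwd i) h • c = c.
Proof. by rewrite -vassoc gen_fb vidl. Qed.

End Strict.

Ltac reify1 f :=
  lazymatch f with
  | @comp1 ?D ?x ?y ?z ?g ?f =>
      let g' := reify1 g in let f' := reify1 f in
      constr:(@tc D x y z g' f')
  | @id1 ?D ?x => constr:(@t1 D x)
  | _ => constr:(@tv _ _ _ f)
  end.

(* f, g are the source and target of the 2-cell c *)
Ltac reify2 f g c :=
  lazymatch c with
  | @vcomp ?D ?x ?y ?f1 ?f2 ?f3 ?b ?a =>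
      let b' := reify2 f2 f3 b in let a' := reify2 f1 f2 a in
      constr:(cc b' a')
  | @id2 ?D ?x ?y ?f => let f' := reify1 f in constr:(@ci D x y f')
  | @lwh ?D ?x ?y ?z ?g ?f1 ?f2 ?a =>
      let g' := reify1 g in let a' := reify2 f1 f2 a in constr:(cl g' a')
  | @rwh ?D ?x ?y ?z ?g1 ?g2 ?b ?f =>
      let b' := reify2 g1 g2 b in let f' := reify1 f in constr:(cr b' f')
  | @lun ?D ?x ?y ?f => let f' := reify1 f in constr:(clun f')
  | @luni ?D ?x ?y ?f => let f' := reify1 f in constr:(cluni f')
  | @run ?D ?x ?y ?f => let f' := reify1 f in constr:(crun f')
  | @runi ?D ?x ?y ?f => let f' := reify1 f in constr:(cruni f')
  | @asc ?D ?w ?x ?y ?z ?h ?g ?f =>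
      let h' := reify1 h in let g' := reify1 g in let f' := reify1 f in
      constr:(casc h' g' f')
  | @asci ?D ?w ?x ?y ?z ?h ?g ?f =>
      let h' := reify1 h in let g' := reify1 g in let f' := reify1 f in
      constr:(casci h' g' f')
  | @fwd ?D ?x ?y ?f ?g ?i =>
      let s := reify1 f in let t := reify1 g in
      constr:(@cv D x y s t c)
  | @bwd ?D ?x ?y ?f ?g ?i =>
      let s := reify1 g in let t := reify1 f in
      constr:(@cv D x y s t c)
  | _ =>
      let s := reify1 f in let t := reify1 g in
      constr:(@cv _ _ _ s t c)
  end.

Ltac vnorm := rewrite ?lwh_comp ?lwh_id ?vassoc ?vidl ?vidr.

Ltac strictify :=
  lazymatch goal with
  | |- @eq (@Cell ?D ?x ?y ?f ?g) ?a ?b =>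
      let c := reify2 f g a in let d := reify2 f g b in
      apply: (@actcP D x y _ _ c d); let w := fresh "w" in let h := fresh "h" in
      move=> w h; cbn [actc act act2]; vnorm
  end.

Ltac strictify_in H :=
  lazymatch type of H with
  | @eq (@Cell ?D ?x ?y ?f ?g) ?a ?b =>
      let c := reify2 f g a in let d := reify2 f g b in
      let w := fresh "w" in let h := fresh "h" in
      move: (@actcI D x y _ _ c d H) => {H};
      cbn [actc act act2]; move=> H
  end.

(* naturality of the action of the 2-cell a : f => g in its argument *)
Ltac natural a N :=
  let T := type of a in
  lazymatch T with
  | @Cell ?D ?x ?y ?f ?g =>
      let s := reify1 f in let t := reify1 g in
      have N := fun w h h' => @gen_nat D x y s t a w h h';
      cbn [actc act act2] in N
  | @iso2 ?D ?x ?y ?f ?g =>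
      let s := reify1 f in let t := reify1 g in
      have N := fun w h h' => @gen_nat D x y s t (fwd a) w h h';
      cbn [actc act act2] in N
  end.

Ltac natural_k a N :=
  natural a N;
  let T := type of N in
  match T with
  | forall w h h' c, @?P w h h' c =>
      let M := fresh "M" in
      rename N into M; have N := fun w h h' c k => @vk _ _ _ _ _ _ k _ _ _ (M w h h' c);
      clear M
  end.

Ltac cancel_fb i :=
  let T := type of i in
  lazymatch T with
  | @iso2 ?D ?x ?y ?f ?g =>
      let s := reify1 f in let t := reify1 g in
      let M := fresh "M" in
      have M := fun w h k => @gen_fb_k D x y s t i w h k;
      cbn [actc act act2] in M; rewrite M; clear M
  end.

Ltac strictify_k E :=
  strictify_in E;
  let M := fresh "M" in
  rename E into M; have E := fun w h k => @vk _ _ _ _ _ _ k _ _ _ (M w h);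
  clear M.

Ltac coh := by strictify.

(* The action on cells is separated from the comparison 2-cells, and both records
   have definitional eta: (HG)F and H(GF), or 1F and F, have convertible PsData
   and differ only in their PsStr, which moreover agree (see [agree] below). *)
Set Primitive Projections.

Record PsData (A B : Bicat) := mkPsData {
  f0 :> A -> B;
  f1 : forall {x y : A}, Hom x y -> Hom (f0 x) (f0 y);
  f2 : forall {x y : A} {f g : Hom x y}, Cell f g -> Cell (f1 f) (f1 g)
}.

Record PsStr (A B : Bicat) (F : PsData A B) := mkPsStr {
  fid : forall x : A, id1 (F x) ≅ f1 F (id1 x);
  fcomp : forall (x y z : A) (g : Hom y z) (f : Hom x y),
    f1 F g ∘ f1 F f ≅ f1 F (g ∘ f);
  f2_id : forall (x y : A) (f : Hom x y), f2 F (id2 f) = id2 (f1 F f);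
  f2_comp : forall (x y : A) (f g h : Hom x y) (b : Cell g h) (a : Cell f g),
    f2 F (b • a) = f2 F b • f2 F a;
  fcomp_l : forall (x y z : A) (g : Hom y z) (f f' : Hom x y) (a : Cell f f'),
    f2 F (g ◁ a) • fwd (fcomp g f) = fwd (fcomp g f') • (f1 F g ◁ f2 F a);
  fcomp_r : forall (x y z : A) (g g' : Hom y z) (f : Hom x y) (b : Cell g g'),
    f2 F (b ▷ f) • fwd (fcomp g f) = fwd (fcomp g' f) • (f2 F b ▷ f1 F f);
  flun : forall (x y : A) (f : Hom x y),
    f2 F (lun f) • fwd (fcomp (id1 y) f) • (fwd (fid y) ▷ f1 F f) = lun (f1 F f);
  frun : forall (x y : A) (f : Hom x y),
    f2 F (run f) • fwd (fcomp f (id1 x)) • (f1 F f ◁ fwd (fid x)) = run (f1 F f);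
  fasc : forall (w x y z : A) (h : Hom y z) (g : Hom x y) (f : Hom w x),
    f2 F (asc h g f) • fwd (fcomp (h ∘ g) f) • (fwd (fcomp h g) ▷ f1 F f) =
    fwd (fcomp h (g ∘ f)) • (f1 F h ◁ fwd (fcomp g f)) •
      asc (f1 F h) (f1 F g) (f1 F f)
}.

Record Psfun (A B : Bicat) := mkPsfun {
  psd :> PsData A B;
  pss : PsStr psd
}.

Unset Primitive Projections.

Arguments fid {A B F} _ x.
Arguments fcomp {A B F} _ {x y z} g f.

Record PsNat (A B : Bicat) (F G : Psfun A B) := mkPsNat {
  pc :> forall x : A, Hom (F x) (G x);
  pn : forall {x y : A} (f : Hom x y), f1 G f ∘ pc x ≅ pc y ∘ f1 F f;
  pn_nat : forall (x y : A) (f g : Hom x y) (a : Cell f g),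
    fwd (pn g) • (f2 G a ▷ pc x) = (pc y ◁ f2 F a) • fwd (pn f);
  pn_id : forall x : A,
    fwd (pn (id1 x)) • (fwd (fid (pss G) x) ▷ pc x) =
    (pc x ◁ fwd (fid (pss F) x)) • runi (pc x) • lun (pc x);
  pn_comp : forall (x y z : A) (g : Hom y z) (f : Hom x y),
    fwd (pn (g ∘ f)) • (fwd (fcomp (pss G) g f) ▷ pc x) =
    (pc z ◁ fwd (fcomp (pss F) g f)) • asc (pc z) (f1 F g) (f1 F f) •
      (fwd (pn g) ▷ f1 F f) • asci (f1 G g) (pc y) (f1 F f) •
      (f1 G g ◁ fwd (pn f)) • asc (f1 G g) (f1 G f) (pc x)
}.

Record Mod (A B : Bicat) (F G : Psfun A B) (s t : PsNat F G) := mkMod {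
  mc :> forall x : A, Cell (s x) (t x);
  mc_nat : forall (x y : A) (f : Hom x y),
    (mc y ▷ f1 F f) • fwd (pn s f) = fwd (pn t f) • (f1 G f ◁ mc x)
}.

Lemma Mod_eq A B (F G : Psfun A B) (s t : PsNat F G) (m n : Mod s t) :
  (forall x, m x = n x) -> m = n.
Proof.
case: m n => [m hm] [n hn] /= e.
have e' : m = n by apply: functional_extensionality_dep.
by subst n; rewrite (proof_irrelevance _ hm hn).
Qed.

Section PsBicat.
Context (A B : Bicat).

Section Id.
Context (F : Psfun A B).
Definition idn_pn (x y : A) (f : Hom x y) :
  f1 F f ∘ id1 (F x) ≅ id1 (F y) ∘ f1 F f :=
  iso_trans (iso_run (f1 F f)) (iso_sym (iso_lun (f1 F f))).

Definition idn : PsNat F F.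
Proof.
refine (@mkPsNat A B F F (fun x => id1 (F x)) idn_pn _ _ _); rewrite /idn_pn /=.
- move=> x y f g a; coh.
- abstract (move=> x; coh).
- abstract (move=> x y z g f; coh).
Defined.
End Id.

Section Comp.
Context (F G H : Psfun A B) (t : PsNat G H) (s : PsNat F G).

Definition compn_pn (x y : A) (f : Hom x y) :
  f1 H f ∘ (t x ∘ s x) ≅ (t y ∘ s y) ∘ f1 F f :=
  iso_trans (iso_sym (iso_asc (f1 H f) (t x) (s x)))
  (iso_trans (iso_rwh (pn t f) (s x))
  (iso_trans (iso_asc (t y) (f1 G f) (s x))
  (iso_trans (iso_lwh (t y) (pn s f))
    (iso_sym (iso_asc (t y) (s y) (f1 F f)))))).

Definition compn : PsNat F H.
Proof.
refine (@mkPsNat A B F H (fun x => t x ∘ s x) compn_pn _ _ _); rewrite /compn_pn /=.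
- abstract (move=> x y f g a;
  have E := pn_nat t a; have E' := pn_nat s a;
  strictify_in E; strictify_in E'; strictify;
  by rewrite E -vassoc -lwh_comp E' lwh_comp vassoc).
- abstract (move=> x;
  have E := pn_id t x; have E' := pn_id s x;
  strictify_in E; strictify_in E'; strictify;
  rewrite E; vnorm; by rewrite -lwh_comp E'; vnorm).
- abstract (move=> x y z g f;
  have E := pn_comp t g f; have E' := pn_comp s g f;
  strictify_in E; strictify_in E'; strictify;
  rewrite E; vnorm; rewrite -vassoc -lwh_comp E'; vnorm;
  natural_k (pn t g) N; by rewrite N vassoc).
Defined.
End Comp.

Section Mods.
Context (F G : Psfun A B).

Definition idm (s : PsNat F G) : Mod s s.
Proof.
refine (@mkMod A B F G s s (fun x => id2 (s x)) _).
abstract (move=> x y f; by rewrite rwh_id lwh_id vidl vidr).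
Defined.

Definition vcompm (s t u : PsNat F G) (n : Mod t u) (m : Mod s t) : Mod s u.
Proof.
refine (@mkMod A B F G s u (fun x => n x • m x) _).
abstract (move=> x y f; have E := mc_nat n f; have E' := mc_nat m f;
  by rewrite rwh_comp lwh_comp vassoc E' -vassoc E vassoc).
Defined.

Definition iso_mod_of (s t : PsNat F G) (m : forall x, s x ≅ t x)
  (h : forall (x y : A) (f : Hom x y),
    (fwd (m y) ▷ f1 F f) • fwd (pn s f) = fwd (pn t f) • (f1 G f ◁ fwd (m x))) :
  forall (x y : A) (f : Hom x y),
    (bwd (m y) ▷ f1 F f) • fwd (pn t f) = fwd (pn s f) • (f1 G f ◁ bwd (m x)).
Proof.
move=> x y f.
apply: (iso_epic (i := iso_lwh (f1 G f) (m x))) => /=.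
rewrite !vassoc -lwh_comp bwd_fwd lwh_id vidr -h -vassoc -rwh_comp bwd_fwd.
by rewrite rwh_id vidl.
Qed.

End Mods.

Section Whisk.
Context (F G H : Psfun A B).

Definition lwhm (t : PsNat G H) (s s' : PsNat F G) (m : Mod s s') :
  Mod (compn t s) (compn t s').
Proof.
refine (@mkMod A B F H (compn t s) (compn t s') (fun x => t x ◁ m x) _).
abstract (move=> x y f; have E := mc_nat m f;
  rewrite /= /compn_pn /=; strictify_in E; strictify;
  rewrite -vassoc -lwh_comp E; vnorm;
  natural (pn t f) N; by rewrite N).
Defined.

Definition rwhm (t t' : PsNat G H) (m : Mod t t') (s : PsNat F G) :
  Mod (compn t s) (compn t' s).
Proof.
refine (@mkMod A B F H (compn t s) (compn t' s) (fun x => m x ▷ s x) _).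
abstract (move=> x y f; have E := mc_nat m f;
  rewrite /= /compn_pn /=; strictify_in E; strictify;
  natural_k (m y) N; by rewrite N vassoc E).
Defined.

End Whisk.

Definition lunm (F G : Psfun A B) (s : PsNat F G) : Mod (compn (idn G) s) s.
Proof.
refine (@mkMod A B F G (compn (idn G) s) s (fun x => lun (s x)) _).
abstract (move=> x y f; rewrite /= /compn_pn /idn_pn /=; coh).
Defined.

Definition runm (F G : Psfun A B) (s : PsNat F G) : Mod (compn s (idn F)) s.
Proof.
refine (@mkMod A B F G (compn s (idn F)) s (fun x => run (s x)) _).
abstract (move=> x y f; rewrite /= /compn_pn /idn_pn /=; coh).
Defined.

Definition ascm (E F G H : Psfun A B) (u : PsNat G H) (t : PsNat F G)
  (s : PsNat E F) : Mod (compn (compn u t) s) (compn u (compn t s)).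
Proof.
refine (@mkMod A B E H (compn (compn u t) s) (compn u (compn t s))
  (fun x => asc (u x) (t x) (s x)) _).
abstract (move=> x y f; rewrite /= /compn_pn /compn_pn /=; coh).
Defined.

Definition lunim (F G : Psfun A B) (s : PsNat F G) : Mod s (compn (idn G) s) :=
  @mkMod A B F G s (compn (idn G) s) (fun x => luni (s x))
    (@iso_mod_of F G (compn (idn G) s) s (fun x => iso_lun (s x))
       (mc_nat (lunm s))).

Definition runim (F G : Psfun A B) (s : PsNat F G) : Mod s (compn s (idn F)) :=
  @mkMod A B F G s (compn s (idn F)) (fun x => runi (s x))
    (@iso_mod_of F G (compn s (idn F)) s (fun x => iso_run (s x))
       (mc_nat (runm s))).

Definition ascim (E F G H : Psfun A B) (u : PsNat G H) (t : PsNat F G)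
  (s : PsNat E F) : Mod (compn u (compn t s)) (compn (compn u t) s) :=
  @mkMod A B E H (compn u (compn t s)) (compn (compn u t) s)
    (fun x => asci (u x) (t x) (s x))
    (@iso_mod_of E H (compn (compn u t) s) (compn u (compn t s))
       (fun x => iso_asc (u x) (t x) (s x)) (mc_nat (ascm u t s))).

Definition PsBicat : Bicat.
Proof.
refine (@mkBicat (Psfun A B) (@PsNat A B) (@Mod A B) idn
  (fun F G H t s => compn t s) (fun F G s => idm s)
  (fun F G s t u n m => vcompm n m)
  (fun F G H t s s' m => lwhm t m) (fun F G H t t' m s => rwhm m s)
  (fun F G s => lunm s) (fun F G s => lunim s)
  (fun F G s => runm s) (fun F G s => runim s)
  (fun E F G H u t s => ascm u t s) (fun E F G H u t s => ascim u t s)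
  _ _ _ _ _ _ _ _ _ _ _ _ _ _ _ _ _ _ _ _ _);
abstract (intros; apply: Mod_eq => ? /=;
  first [ exact: vidl | exact: vidr | exact: vassoc | exact: lwh_id
        | exact: rwh_id | exact: lwh_comp | exact: rwh_comp
        | exact: interchange | exact: lun_nat | exact: run_nat
        | exact: asc_nat_l | exact: asc_nat_m | exact: asc_nat_r
        | exact: lun_luni | exact: luni_lun | exact: run_runi
        | exact: runi_run | exact: asc_asci | exact: asci_asc
        | exact: triangle | exact: pentagon ]).
Defined.

End PsBicat.

Canonical PsBicat.

Definition iso_mod (A B : Bicat) (F G : Psfun A B) (s t : PsNat F G)
  (m : forall x, s x ≅ t x)
  (h : forall (x y : A) (f : Hom x y),
    (fwd (m y) ▷ f1 F f) • fwd (pn s f) = fwd (pn t f) • (f1 G f ◁ fwd (m x))) :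
  s ≅ t.
Proof.
refine (@Iso2 (PsBicat A B) F G s t (mkMod h) (mkMod (iso_mod_of h)) _ _).
- abstract (apply: Mod_eq => x /=; exact: bwd_fwd).
- abstract (apply: Mod_eq => x /=; exact: fwd_bwd).
Defined.

Definition psid_data (A : Bicat) : PsData A A :=
  @mkPsData A A (fun x => x) (fun x y f => f) (fun x y f g a => a).

Definition psid (A : Bicat) : Psfun A A.
Proof.
refine (@mkPsfun A A (psid_data A) (@mkPsStr A A (psid_data A)
  (fun x => iso_refl (id1 x)) (fun x y z g f => iso_refl (g ∘ f))
  _ _ _ _ _ _ _)) => /=.
- abstract by [].
- abstract by [].
- abstract (move=> x y z g f f' a; coh).
- abstract (move=> x y z g g' f b; coh).
- abstract (move=> x y f; coh).
- abstract (move=> x y f; coh).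
- abstract (move=> w x y z h g f; coh).
Defined.

Definition f2_iso (A B : Bicat) (F : Psfun A B) (x y : A) (f g : Hom x y)
  (i : f ≅ g) : f1 F f ≅ f1 F g.
Proof.
refine (@Iso2 B _ _ _ _ (f2 F (fwd i)) (f2 F (bwd i)) _ _).
- abstract (by rewrite -(f2_comp (pss F)) bwd_fwd (f2_id (pss F))).
- abstract (by rewrite -(f2_comp (pss F)) fwd_bwd (f2_id (pss F))).
Defined.

Section PsComp.
Context (A B C : Bicat) (G : Psfun B C) (F : Psfun A B).

Definition pscomp_data : PsData A C :=
  @mkPsData A C (fun x => G (F x)) (fun x y f => f1 G (f1 F f))
    (fun x y f g a => f2 G (f2 F a)).

Definition pscomp_fid (x : A) : id1 (G (F x)) ≅ f1 G (f1 F (id1 x)) :=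
  iso_trans (fid (pss G) (F x)) (f2_iso G (fid (pss F) x)).

Definition pscomp_fcomp (x y z : A) (g : Hom y z) (f : Hom x y) :
  f1 G (f1 F g) ∘ f1 G (f1 F f) ≅ f1 G (f1 F (g ∘ f)) :=
  iso_trans (fcomp (pss G) (f1 F g) (f1 F f)) (f2_iso G (fcomp (pss F) g f)).

Definition pscomp : Psfun A C.
Proof.
refine (@mkPsfun A C pscomp_data (@mkPsStr A C pscomp_data
  pscomp_fid pscomp_fcomp _ _ _ _ _ _ _)) => /=;
rewrite /pscomp_fid /pscomp_fcomp /=.
- abstract (move=> x y f; by rewrite (f2_id (pss F)) (f2_id (pss G))).
- abstract (move=> x y f g h b a; by rewrite (f2_comp (pss F)) (f2_comp (pss G))).
- abstract (move=> x y z g f f' a;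
  by rewrite -vassoc -(f2_comp (pss G)) (fcomp_l (pss F)) (f2_comp (pss G)) !vassoc
     (fcomp_l (pss G))).
- abstract (move=> x y z g g' f b;
  by rewrite -vassoc -(f2_comp (pss G)) (fcomp_r (pss F)) (f2_comp (pss G)) !vassoc
     (fcomp_r (pss G))).
- abstract (move=> x y f;
  rewrite rwh_comp !vassoc -(vassoc _ _ (_ ▷ _)) -(fcomp_r (pss G));
  rewrite -(flun (pss G)) -(flun (pss F)) !(f2_comp (pss G)) !vassoc //).
- abstract (move=> x y f;
  rewrite lwh_comp !vassoc -(vassoc _ _ (_ ◁ _)) -(fcomp_l (pss G));
  rewrite -(frun (pss G)) -(frun (pss F)) !(f2_comp (pss G)) !vassoc //).
- abstract (move=> w x y z h g f;
  rewrite rwh_comp lwh_comp !vassoc;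
  rewrite -(vassoc (fwd (fcomp (pss G) (f1 F (h ∘ g)) (f1 F f)))) -(fcomp_r (pss G)) !vassoc;
  have E := f_equal (fun c => f2 G c) (fasc (pss F) h g f);
  rewrite /= !(f2_comp (pss G)) in E;
  have := vk E (fcomp (pss G) (f1 F h ∘ f1 F g) (f1 F f) •
    (fcomp (pss G) (f1 F h) (f1 F g) ▷ f1 G (f1 F f)));
  rewrite !vassoc => ->;
  rewrite (fasc (pss G)) -(vassoc _ (fwd (fcomp (pss G) _ _))) (fcomp_l (pss G));
  by rewrite !vassoc).
Defined.
End PsComp.

Notation "G ⊚ F" := (pscomp G F) (at level 40, left associativity).

Lemma fasci (A B : Bicat) (F : Psfun A B) (w x y z : A) (h : Hom y z)
  (g : Hom x y) (f : Hom w x) :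
  f2 F (asci h g f) • fwd (fcomp (pss F) h (g ∘ f)) •
    (f1 F h ◁ fwd (fcomp (pss F) g f)) =
  fwd (fcomp (pss F) (h ∘ g) f) • (fwd (fcomp (pss F) h g) ▷ f1 F f) •
    asci (f1 F h) (f1 F g) (f1 F f).
Proof.
apply: (iso_monic (i := f2_iso F (iso_asc h g f))) => /=.
rewrite -vassoc -(f2_comp (pss F)) asc_asci (f2_id (pss F)) vidl.
have := vk (fasc (pss F) h g f) (asci (f1 F h) (f1 F g) (f1 F f)).
by rewrite !vassoc asc_asci vidr => ->.
Qed.

Section Whr.
Context (A B C : Bicat).

Definition whr (G G' : Psfun B C) (s : PsNat G G') (F : Psfun A B) :
  PsNat (G ⊚ F) (G' ⊚ F).
Proof.
refine (@mkPsNat A C (G ⊚ F) (G' ⊚ F) (fun x => s (F x))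
  (fun x y f => pn s (f1 F f)) _ _ _) => /=.
- abstract (move=> x y f g a; exact: pn_nat).
- abstract (move=> x; rewrite /pscomp_fid /= rwh_comp -vassoc (pn_nat s) !vassoc;
  by rewrite (pn_id s) lwh_comp !vassoc).
- abstract (move=> x y z g f; rewrite /pscomp_fcomp /= rwh_comp -vassoc (pn_nat s);
  by rewrite !vassoc (pn_comp s) lwh_comp !vassoc).
Defined.

Definition whrm (G G' : Psfun B C) (s t : PsNat G G') (m : Mod s t)
  (F : Psfun A B) : Mod (whr s F) (whr t F) :=
  @mkMod A C (G ⊚ F) (G' ⊚ F) (whr s F) (whr t F) (fun x => m (F x))
    (fun x y f => mc_nat m (f1 F f)).

Definition whl_pn (G : Psfun B C) (F F' : Psfun A B) (s : PsNat F F')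
  (x y : A) (f : Hom x y) :
  f1 G (f1 F' f) ∘ f1 G (s x) ≅ f1 G (s y) ∘ f1 G (f1 F f) :=
  iso_trans (fcomp (pss G) (f1 F' f) (s x))
    (iso_trans (f2_iso G (pn s f)) (iso_sym (fcomp (pss G) (s y) (f1 F f)))).

Definition whl (G : Psfun B C) (F F' : Psfun A B) (s : PsNat F F') :
  PsNat (G ⊚ F) (G ⊚ F').
Proof.
refine (@mkPsNat A C (G ⊚ F) (G ⊚ F') (fun x => f1 G (s x)) (whl_pn G s) _ _ _);
rewrite /whl_pn /=.
- abstract (move=> x y f g a;
  rewrite !vassoc -(fcomp_r (pss G)) -(vassoc (f2 G _) (f2 G _));
  rewrite -(f2_comp (pss G)) (pn_nat s) (f2_comp (pss G)) !vassoc;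
  apply: (iso_monic (i := fcomp (pss G) (s y) (f1 F g)));
  rewrite fwd_bwd_k -(vassoc _ (_ ◁ _)) -(fcomp_l (pss G));
  by rewrite vassoc fwd_bwd_k).
- abstract (move=> x; rewrite /pscomp_fid /= rwh_comp lwh_comp !vassoc;
  rewrite -(vassoc (fwd (fcomp _ _ _))) -(fcomp_r (pss G)) !vassoc;
  rewrite -(vassoc (f2 G _) (f2 G _)) -(f2_comp (pss G)) (pn_id s);
  rewrite !(f2_comp (pss G)) !vassoc;
  rewrite (flun (pss G));
  apply: (iso_monic (i := fcomp (pss G) (s x) (f1 F (id1 x))));
  rewrite fwd_bwd_k -(vassoc _ (_ ◁ _)) -(fcomp_l (pss G)) !vassoc;
  congr (_ • _); rewrite -!vassoc; congr (_ • _);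
  apply: (iso_monic (i := f2_iso G (iso_run (s x)))) => /=;
  rewrite -(f2_comp (pss G)) run_runi (f2_id (pss G));
  by rewrite -(run_runi (f1 G (s x))) -(frun (pss G)) !vassoc).
- abstract (move=> x y z g f; rewrite /pscomp_fcomp /=;
  apply: (iso_monic (i := fcomp (pss G) (s z) (f1 F (g ∘ f))));
  rewrite !vassoc fwd_bwd_k;
  rewrite !rwh_comp !lwh_comp !vassoc;
  rewrite -(vassoc (fwd (fcomp (pss G) (f1 F' (g ∘ f)) (s x)))) -(fcomp_r (pss G)) !vassoc;
  rewrite -(vassoc (f2 G _) (f2 G _)) -(f2_comp (pss G)) (pn_comp s g f);
  rewrite !(f2_comp (pss G)) !vassoc;
  rewrite (fasc (pss G));
  rewrite -(vassoc (f2 G (f1 F' g ◁ _))) (fcomp_l (pss G)) !vassoc;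
  rewrite -(vassoc _ (f1 G (s z) ◁ f2 G _)) -(fcomp_l (pss G)) !vassoc;
  congr (_ • _);
  have H1 : f2 G (asci (f1 F' g) (s y) (f1 F f)) •
    fwd (fcomp (pss G) (f1 F' g) (s y ∘ f1 F f)) =
    fwd (fcomp (pss G) (f1 F' g ∘ s y) (f1 F f)) •
    (fwd (fcomp (pss G) (f1 F' g) (s y)) ▷ f1 G (f1 F f)) •
    asci _ _ _ • (f1 G (f1 F' g) ◁ bwd (fcomp (pss G) (s y) (f1 F f)));
  [ apply: (iso_epic (i := iso_lwh (f1 G (f1 F' g)) (fcomp (pss G) (s y) (f1 F f))));
    by rewrite /= !vassoc -lwh_comp bwd_fwd lwh_id vidr fasci |];
  have H2 : f2 G (asc (s z) (f1 F g) (f1 F f)) •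
    fwd (fcomp (pss G) (s z ∘ f1 F g) (f1 F f)) =
    fwd (fcomp (pss G) (s z) (f1 F g ∘ f1 F f)) •
    (f1 G (s z) ◁ fwd (fcomp (pss G) (f1 F g) (f1 F f))) •
    asc _ _ _ • (bwd (fcomp (pss G) (s z) (f1 F g)) ▷ f1 G (f1 F f));
  [ apply: (iso_epic (i := iso_rwh (fcomp (pss G) (s z) (f1 F g)) (f1 G (f1 F f))));
    by rewrite /= !vassoc -rwh_comp bwd_fwd rwh_id vidr fasc |];
  rewrite (vk H1) !vassoc;
  rewrite -(vassoc (f2 G (_ ▷ _))) (fcomp_r (pss G)) !vassoc;
  by rewrite (vk H2) !vassoc).
Defined.

Definition whlm (G : Psfun B C) (F F' : Psfun A B) (s t : PsNat F F')
  (m : Mod s t) : Mod (whl G s) (whl G t).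
Proof.
refine (@mkMod A C _ _ (whl G s) (whl G t) (fun x => f2 G (m x)) _).
abstract (move=> x y f; rewrite /= /whl_pn /=;
  apply: (iso_monic (i := fcomp (pss G) (t y) (f1 F f)));
  rewrite !vassoc fwd_bwd_k -(vassoc _ (_ ▷ _)) -(fcomp_r (pss G));
  rewrite vassoc fwd_bwd_k -vassoc -(f2_comp (pss G)) (mc_nat m f);
  by rewrite (f2_comp (pss G)) !vassoc (fcomp_l (pss G))).
Defined.
End Whr.

Record agree (A B : Bicat) (D : PsData A B) (P Q : PsStr D) : Prop := Agree {
  agree_id : forall x : A, fwd (fid P x) = fwd (fid Q x);
  agree_comp : forall (x y z : A) (g : Hom y z) (f : Hom x y),
    fwd (fcomp P g f) = fwd (fcomp Q g f)
}.

Lemma agree_refl (A B : Bicat) (D : PsData A B) (P : PsStr D) : agree P P.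
Proof. by []. Qed.

Lemma agree_sym (A B : Bicat) (D : PsData A B) (P Q : PsStr D) :
  agree P Q -> agree Q P.
Proof. by case=> h k; split=> *; rewrite ?h ?k. Qed.

Lemma agree_trans (A B : Bicat) (D : PsData A B) (P Q R : PsStr D) :
  agree P Q -> agree Q R -> agree P R.
Proof. by case=> h k [h' k']; split=> *; rewrite ?h ?k. Qed.

Lemma agree_assoc (A B C E : Bicat) (H : Psfun C E) (G : Psfun B C)
  (F : Psfun A B) : agree (pss ((H ⊚ G) ⊚ F)) (pss (H ⊚ (G ⊚ F))).
Proof.
by split=> * /=; rewrite /pscomp_fid /pscomp_fcomp /= (f2_comp (pss H)) vassoc.
Qed.

Lemma agree_1l (A B : Bicat) (F : Psfun A B) :
  agree (pss (psid B ⊚ F)) (pss F).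
Proof. by split=> * /=; rewrite vidr. Qed.

Lemma agree_1r (A B : Bicat) (F : Psfun A B) :
  agree (pss (F ⊚ psid A)) (pss F).
Proof. by split=> * /=; rewrite (f2_id (pss F)) vidl. Qed.

Section Recast.
Context (A B : Bicat).

Definition recast (D D' : PsData A B) (P P' : PsStr D) (Q Q' : PsStr D')
  (a : agree P P') (b : agree Q Q') (s : PsNat (mkPsfun P) (mkPsfun Q)) :
  PsNat (mkPsfun P') (mkPsfun Q').
Proof.
refine (@mkPsNat A B (mkPsfun P') (mkPsfun Q') (pc s) (fun x y f => pn s f)
  (pn_nat s) _ _) => /=.
- abstract (move=> x; rewrite -(agree_id a) -(agree_id b); exact: (pn_id s)).
- abstract (move=> x y z g f; rewrite -(agree_comp a) -(agree_comp b);
  exact: (pn_comp s g f)).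
Defined.

(* The transformation with identity components between two pseudofunctors that
   have the same action on cells and equal comparison 2-cells. *)
Definition icon (D : PsData A B) (P Q : PsStr D) (a : agree P Q) :
  PsNat (mkPsfun P) (mkPsfun Q) :=
  recast (agree_refl P) a (idn (mkPsfun P)).

Definition icon_post (D D' : PsData A B) (P : PsStr D) (Q Q' : PsStr D')
  (a : agree Q Q') (s : PsNat (mkPsfun P) (mkPsfun Q)) :
  icon a ∘ s ≅ recast (agree_refl P) a s.
Proof.
refine (@iso_mod A B _ _ (icon a ∘ s) (recast (agree_refl P) a s)
  (fun x => iso_lun (s x)) _).
abstract (move=> x y f; rewrite /= /compn_pn /idn_pn /=; coh).
Defined.

Definition icon_pre (D D' : PsData A B) (P P' : PsStr D) (Q : PsStr D')
  (a : agree P' P) (s : PsNat (mkPsfun P) (mkPsfun Q)) :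
  s ∘ icon a ≅ recast (agree_sym a) (agree_refl Q) s.
Proof.
refine (@iso_mod A B _ _ (s ∘ icon a) (recast (agree_sym a) (agree_refl Q) s)
  (fun x => iso_run (s x)) _).
abstract (move=> x y f; rewrite /= /compn_pn /idn_pn /=; coh).
Defined.

End Recast.

Definition assn (A B C E : Bicat) (H : Psfun C E) (G : Psfun B C)
  (F : Psfun A B) : PsNat ((H ⊚ G) ⊚ F) (H ⊚ (G ⊚ F)) :=
  icon (agree_assoc H G F).

Definition assni (A B C E : Bicat) (H : Psfun C E) (G : Psfun B C)
  (F : Psfun A B) : PsNat (H ⊚ (G ⊚ F)) ((H ⊚ G) ⊚ F) :=
  icon (agree_sym (agree_assoc H G F)).

(* [whr s F] is s_F and [whl G s] is G(s).  Unitors for composition with identity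
   pseudofunctors are suppressed: [whr1 s F : F => KF] and [whl1 G s : G => GK]
   are these whiskerings for s : 1 => K, and [whrc s F : KF => F] and
   [whlc G s : GK => G] those for s : K => 1.  Below, the suffixes 1 and c mark
   in the same way the versions for transformations from or to an identity. *)
Definition whr1 (A B : Bicat) (K : Psfun B B) (s : PsNat (psid B) K)
  (F : Psfun A B) : PsNat F (K ⊚ F) :=
  recast (agree_1l F) (agree_refl _) (whr s F).

Definition whrc (A B : Bicat) (K : Psfun B B) (s : PsNat K (psid B))
  (F : Psfun A B) : PsNat (K ⊚ F) F :=
  recast (agree_refl _) (agree_1l F) (whr s F).

Definition whl1 (A B : Bicat) (G : Psfun A B) (K : Psfun A A)
  (s : PsNat (psid A) K) : PsNat G (G ⊚ K) :=
  recast (agree_1r G) (agree_refl _) (whl G s).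

Definition whlc (A B : Bicat) (G : Psfun A B) (K : Psfun A A)
  (s : PsNat K (psid A)) : PsNat (G ⊚ K) G :=
  recast (agree_refl _) (agree_1r G) (whl G s).

Ltac same_cells := move=> x y f /=; rewrite rwh_id lwh_id vidl vidr.

Section Funct.
Context (A B C : Bicat).

Lemma whl_comp_law (G : Psfun B C) (F F' F'' : Psfun A B) (t : PsNat F' F'')
  (s : PsNat F F') (x y : A) (f : Hom x y) :
  (fwd (fcomp (pss G) (t y) (s y)) ▷ f1 G (f1 F f)) •
    fwd (pn (whl G t ∘ whl G s) f) =
  fwd (pn (whl G (t ∘ s)) f) •
    (f1 G (f1 F'' f) ◁ fwd (fcomp (pss G) (t x) (s x))).
Proof.
rewrite /= /compn_pn /whl_pn /=.
apply: (iso_monic (i := fcomp (pss G) (t y ∘ s y) (f1 F f))).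
rewrite !vassoc fwd_bwd_k !(f2_comp (pss G)) !vassoc.
rewrite !rwh_comp !lwh_comp !vassoc.
have H1 : fwd (fcomp (pss G) (t y ∘ s y) (f1 F f)) •
  (fwd (fcomp (pss G) (t y) (s y)) ▷ f1 G (f1 F f)) • asci _ _ _ •
    (f1 G (t y) ◁ bwd (fcomp (pss G) (s y) (f1 F f))) =
  f2 G (asci (t y) (s y) (f1 F f)) • fwd (fcomp (pss G) (t y) (s y ∘ f1 F f)).
  apply: (iso_epic (i := iso_lwh (f1 G (t y)) (fcomp (pss G) (s y) (f1 F f)))).
  by rewrite /= !vassoc -lwh_comp bwd_fwd lwh_id vidr fasci.
have H2 : f2 G (asc (t y) (f1 F' f) (s x)) •
  fwd (fcomp (pss G) (t y ∘ f1 F' f) (s x)) =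
  fwd (fcomp (pss G) (t y) (f1 F' f ∘ s x)) •
  (f1 G (t y) ◁ fwd (fcomp (pss G) (f1 F' f) (s x))) • asc _ _ _ •
    (bwd (fcomp (pss G) (t y) (f1 F' f)) ▷ f1 G (s x)).
  apply: (iso_epic (i := iso_rwh (fcomp (pss G) (t y) (f1 F' f)) (f1 G (s x)))).
  by rewrite /= !vassoc -rwh_comp bwd_fwd rwh_id vidr fasc.
rewrite fasci -(vassoc (f2 G (_ ▷ _))) (fcomp_r (pss G)) !vassoc.
rewrite (vk H2) !vassoc -(vassoc (f2 G (_ ◁ _))) (fcomp_l (pss G)) !vassoc.
by rewrite (vk (eq_sym H1)) !vassoc.
Qed.

Definition whl_comp (G : Psfun B C) (F F' F'' : Psfun A B) (t : PsNat F' F'')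
  (s : PsNat F F') : whl G t ∘ whl G s ≅ whl G (t ∘ s) :=
  @iso_mod A C _ _ (whl G t ∘ whl G s) (whl G (t ∘ s))
    (fun x => fcomp (pss G) (t x) (s x)) (whl_comp_law G t s).

Definition whl_iso (G : Psfun B C) (F F' : Psfun A B) (s t : PsNat F F')
  (i : s ≅ t) : whl G s ≅ whl G t.
Proof.
refine (@Iso2 (PsBicat A C) _ _ (whl G s) (whl G t)
  (whlm G (fwd i)) (whlm G (bwd i)) _ _).
- abstract (apply: Mod_eq => x /=; rewrite -(f2_comp (pss G)) -(f2_id (pss G));
  congr (f2 G _); by have := f_equal (fun m : Mod s s => m x) (bwd_fwd i)).
- abstract (apply: Mod_eq => x /=; rewrite -(f2_comp (pss G)) -(f2_id (pss G));
  congr (f2 G _); by have := f_equal (fun m : Mod t t => m x) (fwd_bwd i)).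
Defined.

Definition whr_iso (G G' : Psfun B C) (s t : PsNat G G') (i : s ≅ t)
  (F : Psfun A B) : whr s F ≅ whr t F.
Proof.
refine (@Iso2 (PsBicat A C) _ _ (whr s F) (whr t F)
  (whrm (fwd i) F) (whrm (bwd i) F) _ _).
- abstract (apply: Mod_eq => x /=;
  by have := f_equal (fun m : Mod s s => m (F x)) (bwd_fwd i)).
- abstract (apply: Mod_eq => x /=;
  by have := f_equal (fun m : Mod t t => m (F x)) (fwd_bwd i)).
Defined.

Definition whr_comp (G G' G'' : Psfun B C) (t : PsNat G' G'') (s : PsNat G G')
  (F : Psfun A B) : whr t F ∘ whr s F ≅ whr (t ∘ s) F.
Proof.
refine (@iso_mod A C _ _ (whr t F ∘ whr s F) (whr (t ∘ s) F)
  (fun x => iso_refl (t (F x) ∘ s (F x))) _).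
abstract (by same_cells).
Defined.

Definition whr_id (G : Psfun B C) (F : Psfun A B) :
  whr (id1 G) F ≅ id1 (G ⊚ F).
Proof.
refine (@iso_mod A C _ _ (whr (id1 G) F) (id1 (G ⊚ F))
  (fun x => iso_refl (id1 (G (F x)))) _).
abstract (by same_cells).
Defined.

End Funct.

Definition whlc_comp (A B : Bicat) (G : Psfun A B) (K K' : Psfun A A)
  (t : PsNat K' (psid A)) (s : PsNat K K') :
  whlc G t ∘ whl G s ≅ whlc G (t ∘ s) :=
  @iso_mod A B _ _ (whlc G t ∘ whl G s) (whlc G (t ∘ s))
    (fun x => fcomp (pss G) (t x) (s x)) (whl_comp_law G t s).

Definition whr1_comp (A B : Bicat) (K K' : Psfun B B) (t : PsNat K K') (s : PsNat (psid B) K)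
  (F : Psfun A B) : whr t F ∘ whr1 s F ≅ whr1 (t ∘ s) F.
Proof.
refine (@iso_mod A B _ _ (whr t F ∘ whr1 s F) (whr1 (t ∘ s) F)
  (fun x => iso_refl (t (F x) ∘ s (F x))) _).
abstract (by same_cells).
Defined.

Section Exch.
Context (A B C : Bicat).

Lemma exch_law (G G' : Psfun B C) (F F' : Psfun A B) (t : PsNat G G')
  (s : PsNat F F') (x y : A) (f : Hom x y) :
  (fwd (pn t (s y)) ▷ f1 G (f1 F f)) • fwd (pn (whl G' s ∘ whr t F) f) =
  fwd (pn (whr t F' ∘ whl G s) f) • (f1 G' (f1 F' f) ◁ fwd (pn t (s x))).
Proof.
rewrite /= /compn_pn /whl_pn /=.
have E : asc (t (F' y)) (f1 G (s y)) (f1 G (f1 F f)) •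
      (fwd (pn t (s y)) ▷ f1 G (f1 F f)) •
      asci (f1 G' (s y)) (t (F y)) (f1 G (f1 F f)) •
      (f1 G' (s y) ◁ fwd (pn t (f1 F f))) •
      asc (f1 G' (s y)) (f1 G' (f1 F f)) (t (F x)) =
    (t (F' y) ◁ bwd (fcomp (pss G) (s y) (f1 F f))) •
      fwd (pn t (s y ∘ f1 F f)) • (fwd (fcomp (pss G') (s y) (f1 F f)) ▷ t (F x)).
  by rewrite (pn_comp t) -(vassoc (_ ◁ _)) -lwh_comp bwd_fwd lwh_id vidl.
have E' := pn_comp t (f1 F' f) (s x).
have N := pn_nat t (fwd (pn s f)).
strictify_in E; strictify_in E'; strictify_k N; strictify.
move: (E w h); vnorm => E1; rewrite (vk E1); vnorm.
cancel_fb (fcomp (pss G') (s y) (f1 F f)); rewrite N; vnorm; rewrite E'; by vnorm.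
Qed.

Definition exch (G G' : Psfun B C) (F F' : Psfun A B) (t : PsNat G G')
  (s : PsNat F F') : whl G' s ∘ whr t F ≅ whr t F' ∘ whl G s :=
  @iso_mod A C _ _ (whl G' s ∘ whr t F) (whr t F' ∘ whl G s)
    (fun x => pn t (s x)) (exch_law t s).
End Exch.

Definition exch_1l (A B : Bicat) (K : Psfun B B) (F F' : Psfun A B)
  (t : PsNat (psid B) K) (s : PsNat F F') :
  whl K s ∘ whr1 t F ≅ whr1 t F' ∘ s.
Proof.
refine (@iso_mod A B _ _ (whl K s ∘ whr1 t F) (whr1 t F' ∘ s)
  (fun x => pn t (s x)) _).
abstract (move=> x y f; have := exch_law t s f;
  rewrite /= /compn_pn /whl_pn /= vidl vidr; done).
Defined.

Definition exch_s1 (B C : Bicat) (G G' : Psfun B C) (K : Psfun B B)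
  (t : PsNat G G') (s : PsNat (psid B) K) :
  whl1 G' s ∘ t ≅ whr t K ∘ whl1 G s.
Proof.
refine (@iso_mod B C _ _ (whl1 G' s ∘ t) (whr t K ∘ whl1 G s)
  (fun x => pn t (s x)) _).
abstract (move=> x y f; exact: (exch_law t s f)).
Defined.

Definition exch_t1 (B C : Bicat) (G G' : Psfun B C) (K : Psfun B B)
  (t : PsNat G G') (s : PsNat K (psid B)) :
  whlc G' s ∘ whr t K ≅ t ∘ whlc G s.
Proof.
refine (@iso_mod B C _ _ (whlc G' s ∘ whr t K) (t ∘ whlc G s)
  (fun x => pn t (s x)) _).
abstract (move=> x y f; exact: (exch_law t s f)).
Defined.

Section Icon.
Context (A B C : Bicat).

Definition icon_comp (D : PsData A B) (P Q R : PsStr D) (b : agree Q R)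
  (a : agree P Q) (c : agree P R) : icon b ∘ icon a ≅ icon c.
Proof.
refine (@iso_mod A B _ _ (icon b ∘ icon a) (icon c)
  (fun x => iso_lun (id1 (D x))) _).
abstract (move=> x y f; rewrite /= /compn_pn /idn_pn /=; coh).
Defined.

Lemma whl_icon_law (G : Psfun B C) (F : Psfun A B) (x y : A) (f : Hom x y) :
  (fwd (fid (pss G) (F y)) ▷ f1 G (f1 F f)) • fwd (idn_pn (G ⊚ F) f) =
  fwd (pn (whl G (idn F)) f) • (f1 G (f1 F f) ◁ fwd (fid (pss G) (F x))).
Proof.
rewrite /= /whl_pn /idn_pn /=.
apply: (iso_monic (i := fcomp (pss G) (id1 (F y)) (f1 F f))).
apply: (iso_monic (i := f2_iso G (iso_lun (f1 F f)))).
rewrite /= !(f2_comp (pss G)) !vassoc fwd_bwd_k.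
rewrite -[RHS]vassoc -(f2_comp (pss G)) lun_luni (f2_id (pss G)) vidl.
rewrite frun.
have := vk (flun (pss G) (f1 F f)) (luni (f1 G (f1 F f)) • run (f1 G (f1 F f))).
by rewrite !vassoc => ->; rewrite -vassoc lun_luni vidl.
Qed.

Definition whl_icon (G : Psfun B C) (D : PsData A B) (P Q : PsStr D)
  (a : agree P Q)
  (a' : agree (pss (G ⊚ mkPsfun P)) (pss (G ⊚ mkPsfun Q))) :
  whl G (icon a) ≅ icon a' :=
  iso_sym (@iso_mod A C _ _ (icon a') (whl G (icon a))
    (fun x => fid (pss G) (D x)) (whl_icon_law G (mkPsfun P))).

Definition whr_icon (D : PsData B C) (P Q : PsStr D) (a : agree P Q)
  (F : Psfun A B)
  (a' : agree (pss (mkPsfun P ⊚ F)) (pss (mkPsfun Q ⊚ F))) :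
  whr (icon a) F ≅ icon a'.
Proof.
refine (@iso_mod A C _ _ (whr (icon a) F) (icon a')
  (fun x => iso_refl (id1 (D (F x)))) _).
abstract (by same_cells).
Defined.

End Icon.

Section IconSquare.
Context (A B : Bicat) (D D' : PsData A B).
Context (P P' : PsStr D) (Q Q' : PsStr D').

Definition icon_sq (a : agree P P') (b : agree Q Q')
  (s : PsNat (mkPsfun P) (mkPsfun Q)) (t : PsNat (mkPsfun P') (mkPsfun Q'))
  (m : forall x, s x ≅ t x)
  (h : forall (x y : A) (f : Hom x y),
    (fwd (m y) ▷ f1 D f) • fwd (pn s f) = fwd (pn t f) • (f1 D' f ◁ fwd (m x))) :
  icon b ∘ s ≅ t ∘ icon a :=
  iso_trans (icon_post b s)
    (iso_trans
      (@iso_mod A B _ _ (recast (agree_refl P) b s)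
        (recast (agree_sym a) (agree_refl Q') t) m h)
      (iso_sym (icon_pre a t))).

Definition icon_l (b : agree Q Q')
  (s : PsNat (mkPsfun P) (mkPsfun Q)) (t : PsNat (mkPsfun P) (mkPsfun Q'))
  (m : forall x, s x ≅ t x)
  (h : forall (x y : A) (f : Hom x y),
    (fwd (m y) ▷ f1 D f) • fwd (pn s f) = fwd (pn t f) • (f1 D' f ◁ fwd (m x))) :
  icon b ∘ s ≅ t :=
  iso_trans (icon_post b s)
    (@iso_mod A B _ _ (recast (agree_refl P) b s) t m h).

Definition icon_r (a : agree P P')
  (s : PsNat (mkPsfun P) (mkPsfun Q)) (t : PsNat (mkPsfun P') (mkPsfun Q))
  (m : forall x, s x ≅ t x)
  (h : forall (x y : A) (f : Hom x y),
    (fwd (m y) ▷ f1 D f) • fwd (pn s f) = fwd (pn t f) • (f1 D' f ◁ fwd (m x))) :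
  s ≅ t ∘ icon a :=
  iso_trans
    (@iso_mod A B _ _ s (recast (agree_sym a) (agree_refl Q) t) m h)
    (iso_sym (icon_pre a t)).

End IconSquare.

(* [assn_natI] and [assni_natI]: pseudonaturality of the associator and of its
   quasi-inverse in the I-th of the three composed pseudofunctors. *)
Section Nat.
Context (A B C E : Bicat).

Lemma whl_whl_cell (H : Psfun C E) (G : Psfun B C) (F F' : Psfun A B)
  (s : PsNat F F') (x y : A) (f : Hom x y) :
  fwd (pn (whl (H ⊚ G) s) f) = fwd (pn (whl H (whl G s)) f).
Proof. by rewrite /= !(f2_comp (pss H)) !vassoc. Qed.

Definition assn_nat3 (H : Psfun C E) (G : Psfun B C) (F F' : Psfun A B)
  (s : PsNat F F') :
  assn H G F' ∘ whl (H ⊚ G) s ≅ whl H (whl G s) ∘ assn H G F.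
Proof.
refine (@icon_sq A E _ _ _ _ _ _ (agree_assoc H G F) (agree_assoc H G F')
  (whl (H ⊚ G) s) (whl H (whl G s)) (fun x => iso_refl (f1 H (f1 G (s x)))) _).
abstract (move=> x y f; rewrite rwh_id lwh_id vidl vidr;
  exact: whl_whl_cell).
Defined.

Definition assni_nat3 (H : Psfun C E) (G : Psfun B C) (F F' : Psfun A B)
  (s : PsNat F F') :
  assni H G F' ∘ whl H (whl G s) ≅ whl (H ⊚ G) s ∘ assni H G F.
Proof.
refine (@icon_sq A E _ _ _ _ _ _ (agree_sym (agree_assoc H G F))
  (agree_sym (agree_assoc H G F'))
  (whl H (whl G s)) (whl (H ⊚ G) s) (fun x => iso_refl (f1 H (f1 G (s x)))) _).
abstract (move=> x y f; rewrite rwh_id lwh_id vidl vidr;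
  exact: (eq_sym (whl_whl_cell H G s f))).
Defined.

Definition assn_nat1 (K K' : Psfun C E) (s : PsNat K K') (G : Psfun B C)
  (F : Psfun A B) :
  assn K' G F ∘ whr (whr s G) F ≅ whr s (G ⊚ F) ∘ assn K G F.
Proof.
refine (@icon_sq A E _ _ _ _ _ _ (agree_assoc K G F) (agree_assoc K' G F)
  (whr (whr s G) F) (whr s (G ⊚ F)) (fun x => iso_refl (s (G (F x)))) _).
abstract (move=> x y f; by rewrite rwh_id lwh_id vidl vidr).
Defined.

End Nat.

Section NatUnit.
Context (A B C : Bicat).

Definition assni_nat3_1 (H : Psfun B C) (G : Psfun A B) (K : Psfun A A)
  (s : PsNat (psid A) K) :
  assni H G K ∘ whl H (whl1 G s) ≅ whl1 (H ⊚ G) s.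
Proof.
refine (@icon_l A C _ _ _ _ _ (agree_sym (agree_assoc H G K))
  (whl H (whl1 G s)) (whl1 (H ⊚ G) s)
  (fun x => iso_refl (f1 H (f1 G (s x)))) _).
abstract (move=> x y f; rewrite rwh_id lwh_id vidl vidr;
  exact: (eq_sym (whl_whl_cell H G s f))).
Defined.

Definition assn_nat1_1 (K : Psfun C C) (s : PsNat (psid C) K) (G : Psfun B C)
  (F : Psfun A B) :
  assn K G F ∘ whr (whr1 s G) F ≅ whr1 s (G ⊚ F).
Proof.
refine (@icon_l A C _ _ _ _ _ (agree_assoc K G F)
  (whr (whr1 s G) F) (whr1 s (G ⊚ F)) (fun x => iso_refl (s (G (F x)))) _).
abstract (move=> x y f; by rewrite rwh_id lwh_id vidl vidr).
Defined.

Definition assni_nat2_1 (H : Psfun B C) (K : Psfun B B) (s : PsNat (psid B) K)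
  (F : Psfun A B) :
  assni H K F ∘ whl H (whr1 s F) ≅ whr (whl1 H s) F.
Proof.
refine (@icon_l A C _ _ _ _ _ (agree_sym (agree_assoc H K F))
  (whl H (whr1 s F)) (whr (whl1 H s) F)
  (fun x => iso_refl (f1 H (s (F x)))) _).
abstract (move=> x y f; by rewrite rwh_id lwh_id vidl vidr).
Defined.

Definition assn_nat2_c (H : Psfun B C) (K : Psfun B B) (s : PsNat K (psid B))
  (F : Psfun A B) :
  whr (whlc H s) F ≅ whl H (whrc s F) ∘ assn H K F.
Proof.
refine (@icon_r A C _ _ _ _ _ (agree_assoc H K F)
  (whr (whlc H s) F) (whl H (whrc s F))
  (fun x => iso_refl (f1 H (s (F x)))) _).
abstract (move=> x y f; by rewrite rwh_id lwh_id vidl vidr).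
Defined.

End NatUnit.

Lemma agree_whl (A B C : Bicat) (E : Psfun B C) (D : PsData A B)
  (P Q : PsStr D) (a : agree P Q) :
  agree (pss (E ⊚ mkPsfun P)) (pss (E ⊚ mkPsfun Q)).
Proof.
split=> * /=; rewrite /pscomp_fid /pscomp_fcomp /= ?(agree_id a) //.
by rewrite (agree_comp a).
Qed.

Lemma agree_whr (A B C : Bicat) (D : PsData B C) (P Q : PsStr D)
  (a : agree P Q) (E : Psfun A B) :
  agree (pss (mkPsfun P ⊚ E)) (pss (mkPsfun Q ⊚ E)).
Proof.
split=> * /=; rewrite /pscomp_fid /pscomp_fcomp /= ?(agree_id a) //.
by rewrite (agree_comp a).
Qed.

Section Pent.
Context (A0 A1 A2 A3 A4 : Bicat).
Context (K : Psfun A3 A4) (H : Psfun A2 A3) (G : Psfun A1 A2) (F : Psfun A0 A1).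

Definition pent :
  whl K (assn H G F) ∘ (assn K (H ⊚ G) F ∘ whr (assn K H G) F) ≅
  assn K H (G ⊚ F) ∘ assn (K ⊚ H) G F :=
  let a1 := agree_whl K (agree_assoc H G F) in
  let a2 := agree_assoc K (H ⊚ G) F in
  let a3 := agree_whr (agree_assoc K H G) F in
  let b := agree_trans (agree_assoc (K ⊚ H) G F) (agree_assoc K H (G ⊚ F)) in
  iso_trans (iso_rwh (whl_icon (agree_assoc H G F) a1) _)
  (iso_trans (iso_lwh (icon a1)
     (iso_trans (iso_lwh (icon a2) (whr_icon (agree_assoc K H G) a3))
       (icon_comp a2 a3 (agree_trans a3 a2))))
  (iso_trans (icon_comp a1 (agree_trans a3 a2) b)
    (iso_sym (icon_comp (agree_assoc K H (G ⊚ F))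
      (agree_assoc (K ⊚ H) G F) b)))).

(* [pent_r] and [pent_i] are the mates of [pent] obtained by moving associators
   to the other side; all three are composites of the canonical isomorphisms
   between transformations whose components are (isomorphic to) identities. *)
Definition pent_r :
  whl K (assni H G F) ∘ (assn K H (G ⊚ F) ∘ assn (K ⊚ H) G F) ≅
  assn K (H ⊚ G) F ∘ whr (assn K H G) F :=
  let a0 := agree_sym (agree_assoc H G F) in
  let a1 := agree_whl K a0 in
  let a2 := agree_assoc K H (G ⊚ F) in
  let a3 := agree_assoc (K ⊚ H) G F in
  let b1 := agree_assoc K (H ⊚ G) F in
  let b2 := agree_whr (agree_assoc K H G) F in
  let b := agree_trans b2 b1 in
  iso_trans (iso_rwh (whl_icon a0 a1) _)
  (iso_trans (iso_lwh (icon a1) (icon_comp a2 a3 (agree_trans a3 a2)))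
  (iso_trans (icon_comp a1 (agree_trans a3 a2) b)
  (iso_trans (iso_sym (icon_comp b1 b2 b))
    (iso_lwh (icon b1) (iso_sym (whr_icon (agree_assoc K H G) b2)))))).

Definition pent_i :
  assn (K ⊚ H) G F ∘ (whr (assni K H G) F ∘ assni K (H ⊚ G) F) ≅
  assni K H (G ⊚ F) ∘ whl K (assn H G F) :=
  let a0 := agree_sym (agree_assoc K H G) in
  let a1 := agree_assoc (K ⊚ H) G F in
  let a2 := agree_whr a0 F in
  let a3 := agree_sym (agree_assoc K (H ⊚ G) F) in
  let b0 := agree_assoc H G F in
  let b1 := agree_sym (agree_assoc K H (G ⊚ F)) in
  let b2 := agree_whl K b0 in
  let b := agree_trans b2 b1 in
  iso_trans (iso_lwh (icon a1)
    (iso_trans (iso_rwh (whr_icon a0 a2) (icon a3))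
      (icon_comp a2 a3 (agree_trans a3 a2))))
  (iso_trans (icon_comp a1 (agree_trans a3 a2) b)
  (iso_trans (iso_sym (icon_comp b1 b2 b))
    (iso_lwh (icon b1) (iso_sym (whl_icon b0 b2))))).

End Pent.

Definition assn_assni (A B C E : Bicat) (H : Psfun C E) (G : Psfun B C)
  (F : Psfun A B) : assn H G F ∘ assni H G F ≅ id1 (H ⊚ (G ⊚ F)).
Proof.
refine (@icon_l A E _ _ _ _ _ (agree_assoc H G F) (assni H G F)
  (idn (H ⊚ (G ⊚ F))) (fun x => iso_refl (id1 (H (G (F x))))) _).
abstract (move=> x y f; by rewrite rwh_id lwh_id vidl vidr).
Defined.

Record equivalence (D : Bicat) (x y : D) := Equivalence {
  eqv :> Hom x y;
  eqv_inv : Hom y x;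
  eqv_inv_l : eqv_inv ∘ eqv ≅ id1 x;
  eqv_inv_r : eqv ∘ eqv_inv ≅ id1 y
}.

Record biadjunction (A B : Bicat) (L : Psfun A B) (R : Psfun B A) :=
Biadjunction {
  bi_unit : PsNat (psid A) (R ⊚ L);
  bi_counit : PsNat (L ⊚ R) (psid B);
  left_triangle : whrc bi_counit L ∘ (assni L R L ∘ whl1 L bi_unit) ≅ id1 L;
  right_triangle : whlc R bi_counit ∘ (assn R L R ∘ whr1 bi_unit R) ≅ id1 R
}.

Definition is_left_biadjoint (A B : Bicat) (L : Psfun A B) (R : Psfun B A) :=
  inhabited (biadjunction L R).

Record Cat := mkCat {
  ob :> Type;
  hom : ob -> ob -> Type;
  cid : forall x, hom x x;
  ccomp : forall x y z, hom y z -> hom x y -> hom x z;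
  cidl : forall x y (f : hom x y), ccomp (cid y) f = f;
  cidr : forall x y (f : hom x y), ccomp f (cid x) = f;
  cassoc : forall w x y z (h : hom y z) (g : hom x y) (f : hom w x),
    ccomp (ccomp h g) f = ccomp h (ccomp g f)
}.

Record Functor (C D : Cat) := mkFunctor {
  fob :> C -> D;
  fhom : forall x y : C, hom x y -> hom (fob x) (fob y);
  fhom_id : forall x : C, fhom (cid x) = cid (fob x);
  fhom_comp : forall (x y z : C) (g : hom y z) (f : hom x y),
    fhom (ccomp g f) = ccomp (fhom g) (fhom f)
}.

Definition cat_id (C : Cat) : Functor C C :=
  @mkFunctor C C (fun x => x) (fun x y f => f) (fun x => eq_refl)
    (fun x y z g f => eq_refl).

Definition cat_comp (C D E : Cat) (G : Functor D E) (F : Functor C D) :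
  Functor C E.
Proof.
refine (@mkFunctor C E (fun x => G (F x)) (fun x y f => fhom G (fhom F f)) _ _).
- abstract (move=> x; by rewrite !fhom_id).
- abstract (move=> x y z g f; by rewrite !fhom_comp).
Defined.

Record NatIso (C D : Cat) (F G : Functor C D) := mkNatIso {
  ni : forall x : C, hom (F x) (G x);
  ni_inv : forall x : C, hom (G x) (F x);
  ni_nat : forall (x y : C) (f : hom x y),
    ccomp (ni y) (fhom F f) = ccomp (fhom G f) (ni x);
  ni_inv_l : forall x : C, ccomp (ni_inv x) (ni x) = cid (F x);
  ni_inv_r : forall x : C, ccomp (ni x) (ni_inv x) = cid (G x)
}.

Definition is_equivalence (C D : Cat) (F : Functor C D) : Prop :=
  exists G : Functor D C,
    inhabited (NatIso (cat_comp G F) (cat_id C)) /\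
    inhabited (NatIso (cat_comp F G) (cat_id D)).

Definition fully_faithful (C D : Cat) (F : Functor C D) : Prop :=
  forall (x y : C) (g : hom (F x) (F y)),
    exists! f : hom x y, fhom F f = g.

Definition full_subcat (C : Cat) (P : C -> Prop) : Cat :=
  @mkCat {x : C | P x} (fun x y => hom (proj1_sig x) (proj1_sig y))
    (fun x => cid (proj1_sig x)) (fun x y z g f => ccomp g f)
    (fun x y f => cidl f) (fun x y f => cidr f)
    (fun w x y z h g f => cassoc h g f).

Section Inverters.
Context (D : Bicat).

Definition HomCat (x y : D) : Cat :=
  @mkCat (Hom x y) (fun f g => Cell f g) (fun f => id2 f)
    (fun f g h b a => b • a) (fun f g a => vidl a) (fun f g a => vidr a)
    (fun f g h k c b a => vassoc c b a).

Definition postcomp (w x y : D) (f : Hom x y) :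
  Functor (HomCat w x) (HomCat w y) :=
  @mkFunctor (HomCat w x) (HomCat w y) (fun g => f ∘ g)
    (fun g g' a => f ◁ a) (fun g => lwh_id f g)
    (fun g1 g2 g3 b a => lwh_comp f b a).

Definition fully_faithful1 (x y : D) (f : Hom x y) : Prop :=
  forall w : D, fully_faithful (postcomp w f).

Section Inverter.
Context (x1 x2 : D) (f1 f2 : Hom x1 x2) (phi : Cell f1 f2).

Definition is_inverter_cone (x0 : D) (f0 : Hom x0 x1) : Prop :=
  invertible (phi ▷ f0).

Definition InvCone (x0 : D) : Cat :=
  @full_subcat (HomCat x0 x1) (fun f0 => is_inverter_cone f0).

Lemma is_inverter_cone_comp (w x0 : D) (f0 : Hom x0 x1) (g : Hom w x0) :
  is_inverter_cone f0 -> is_inverter_cone (f0 ∘ g).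
Proof.
case=> b [h k].
exists (asc f1 f0 g • (b ▷ g) • asci f2 f0 g).
have E : phi ▷ (f0 ∘ g) = asc f2 f0 g • (phi ▷ f0 ▷ g) • asci f1 f0 g.
  by rewrite -vassoc asc_nat_l vassoc asc_asci vidr.
rewrite E !vassoc; split.
- rewrite -(vassoc (asci _ _ _) (asc _ _ _)) asci_asc vidl.
  by rewrite -(vassoc (b ▷ g)) -rwh_comp h rwh_id vidl asc_asci.
- rewrite -(vassoc (asci _ _ _) (asc _ _ _)) asci_asc vidl.
  by rewrite -(vassoc (_ ▷ g)) -rwh_comp k rwh_id vidl asc_asci.
Qed.

Definition to_InvCone (x0 : D) (f0 : Hom x0 x1) (h : is_inverter_cone f0)
  (w : D) : Functor (HomCat w x0) (InvCone w) :=
  @mkFunctor (HomCat w x0) (InvCone w)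
    (fun g => exist _ (f0 ∘ g) (is_inverter_cone_comp g h))
    (fun g g' a => f0 ◁ a) (fun g => lwh_id f0 g)
    (fun g1 g2 g3 b a => lwh_comp f0 b a).

Definition is_inverter (x0 : D) (f0 : Hom x0 x1) : Prop :=
  exists h : is_inverter_cone f0, forall w : D, is_equivalence (to_InvCone h w).

End Inverter.
End Inverters.

Notation "i ⊙ j" := (iso_trans i j) (at level 50, left associativity).
Notation "g ◂ i" := (iso_lwh g i) (at level 38, right associativity).
Notation "i ▸ f" := (iso_rwh i f) (at level 36, left associativity).

Section Reassociate.
Context {D : Bicat}.
Implicit Types v w x y z : D.

(* An isomorphism between composites of m and n 1-cells, applied to the m leftmost
   factors of a right-nested composite. *)
Definition at22 w x y y' z (a : Hom y z) (b : Hom x y) (c : Hom y' z)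
  (d : Hom x y') (i : a ∘ b ≅ c ∘ d) (r : Hom w x) :
  a ∘ (b ∘ r) ≅ c ∘ (d ∘ r) :=
  iso_sym (iso_asc a b r) ⊙ (i ▸ r) ⊙ iso_asc c d r.

Definition at21 w x y z (a : Hom y z) (b : Hom x y) (c : Hom x z)
  (i : a ∘ b ≅ c) (r : Hom w x) : a ∘ (b ∘ r) ≅ c ∘ r :=
  iso_sym (iso_asc a b r) ⊙ (i ▸ r).

Definition at12 w x y z (a : Hom y z) (b : Hom x y) (c : Hom x z)
  (i : c ≅ a ∘ b) (r : Hom w x) : c ∘ r ≅ a ∘ (b ∘ r) :=
  (i ▸ r) ⊙ iso_asc a b r.

Definition at32 v w x y y' z (a : Hom y z) (b : Hom x y) (c : Hom w x)
  (d : Hom y' z) (e : Hom w y') (i : a ∘ (b ∘ c) ≅ d ∘ e) (r : Hom v w) :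
  a ∘ (b ∘ (c ∘ r)) ≅ d ∘ (e ∘ r) :=
  (a ◂ iso_sym (iso_asc b c r)) ⊙ at22 i r.

End Reassociate.

Section Construction.
Context (A B C : Bicat) (F : Psfun A B) (G : Psfun B C) (H : Psfun A C).
Context (Γ : equivalence (G ⊚ F) H).
Context (L : Psfun B A) (Φ : PsNat (psid B) (F ⊚ L)).
Context (N : Psfun C A) (NH : biadjunction N H).

Local Notation γ := (eqv Γ).
Local Notation γ' := (eqv_inv Γ).
Local Notation Ψ := (bi_unit NH).
Local Notation Υ := (bi_counit NH).

Definition Psi' : PsNat (psid C) ((G ⊚ F) ⊚ N) := whr γ' N ∘ Ψ.

Definition Upsilon' : PsNat (N ⊚ (G ⊚ F)) (psid A) := Υ ∘ whl N γ.

Definition Phi' : PsNat G ((G ⊚ F) ⊚ L) := assni G F L ∘ whl1 G Φ.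

Definition Theta : PsNat (N ⊚ G) L :=
  whrc Upsilon' L ∘ (assni N (G ⊚ F) L ∘ whl N Phi').

Definition Theta' : PsNat ((F ⊚ N) ⊚ G) (F ⊚ L) :=
  whl F Theta ∘ assn F N G.

Definition Psi'' : PsNat (psid C) (G ⊚ (F ⊚ N)) := assn G F N ∘ Psi'.

Definition Xi' : PsNat (F ⊚ N) (((F ⊚ N) ⊚ G) ⊚ (F ⊚ N)) :=
  assni (F ⊚ N) G (F ⊚ N) ∘ whl1 (F ⊚ N) Psi''.

Definition Xi : PsNat (F ⊚ N) ((F ⊚ L) ⊚ (F ⊚ N)) :=
  whr Theta' (F ⊚ N) ∘ Xi'.

Definition Theta'' :
  PsNat (((F ⊚ L) ⊚ (F ⊚ N)) ⊚ G) ((F ⊚ L) ⊚ (F ⊚ L)) :=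
  whl (F ⊚ L) Theta' ∘ assn (F ⊚ L) (F ⊚ N) G.

(* The right triangle of N -| GF, transported from that of N -| H along Γ. *)
Definition right_triangle' :
  whlc (G ⊚ F) Upsilon' ∘ (assn (G ⊚ F) N (G ⊚ F) ∘ whr1 Psi' (G ⊚ F)) ≅
  id1 (G ⊚ F) :=
  (whlc (G ⊚ F) Upsilon' ◂ assn (G ⊚ F) N (G ⊚ F) ◂
     iso_sym (whr1_comp (whr γ' N) Ψ (G ⊚ F)))
  ⊙ (whlc (G ⊚ F) Upsilon' ◂ at22 (assn_nat1 γ' N (G ⊚ F)) (whr1 Ψ (G ⊚ F)))
  ⊙ at22 (exch_t1 γ' Upsilon') (assn H N (G ⊚ F) ∘ whr1 Ψ (G ⊚ F))
  ⊙ (γ' ◂ (iso_sym (whlc_comp H Υ (whl N γ)) ▸ _))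
  ⊙ (γ' ◂ iso_asc (whlc H Υ) (whl H (whl N γ)) _)
  ⊙ (γ' ◂ whlc H Υ ◂ at22 (iso_sym (assn_nat3 H N γ)) (whr1 Ψ (G ⊚ F)))
  ⊙ (γ' ◂ whlc H Υ ◂ assn H N H ◂ exch_1l Ψ γ)
  ⊙ (γ' ◂ (whlc H Υ ◂ iso_sym (iso_asc (assn H N H) (whr1 Ψ H) γ)))
  ⊙ (γ' ◂ at21 (right_triangle NH) γ)
  ⊙ (γ' ◂ iso_lun γ)
  ⊙ eqv_inv_l γ.

Definition phi2''_expand :
  whl G Theta' ∘ (assn G (F ⊚ N) G ∘ whr1 Psi'' G) ≅
  assn G F L ∘ (whl (G ⊚ F) Theta ∘ (assn (G ⊚ F) N G ∘ whr1 Psi' G)) :=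
  (iso_sym (whl_comp G (whl F Theta) (assn F N G)) ▸ _)
  ⊙ iso_asc (whl G (whl F Theta)) (whl G (assn F N G)) _
  ⊙ (whl G (whl F Theta) ◂ whl G (assn F N G) ◂ assn G (F ⊚ N) G ◂
       iso_sym (whr1_comp (assn G F N) Psi' G))
  ⊙ (whl G (whl F Theta) ◂ at32 (pent G F N G) (whr1 Psi' G))
  ⊙ at22 (iso_sym (assn_nat3 G F Theta)) (assn (G ⊚ F) N G ∘ whr1 Psi' G).

Definition phi2''_exch :
  whl (G ⊚ F) Theta ∘ (assn (G ⊚ F) N G ∘ whr1 Psi' G) ≅
  whl (G ⊚ F) (whrc Upsilon' L) ∘
    (whl (G ⊚ F) (assni N (G ⊚ F) L) ∘
      (assn (G ⊚ F) N ((G ⊚ F) ⊚ L) ∘ (whr1 Psi' ((G ⊚ F) ⊚ L) ∘ Phi'))) :=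
  (iso_sym (whl_comp (G ⊚ F) (whrc Upsilon' L)
     (assni N (G ⊚ F) L ∘ whl N Phi')) ▸ _)
  ⊙ iso_asc (whl (G ⊚ F) (whrc Upsilon' L)) _ _
  ⊙ (whl (G ⊚ F) (whrc Upsilon' L) ◂
       ((iso_sym (whl_comp (G ⊚ F) (assni N (G ⊚ F) L) (whl N Phi')) ▸ _)
        ⊙ iso_asc (whl (G ⊚ F) (assni N (G ⊚ F) L)) _ _
        ⊙ (whl (G ⊚ F) (assni N (G ⊚ F) L) ◂
             (at22 (iso_sym (assn_nat3 (G ⊚ F) N Phi')) (whr1 Psi' G)
              ⊙ (assn (G ⊚ F) N ((G ⊚ F) ⊚ L) ◂ exch_1l Psi' Phi'))))).

Definition phi2''_collect :
  whl (G ⊚ F) (whrc Upsilon' L) ∘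
    (whl (G ⊚ F) (assni N (G ⊚ F) L) ∘
      (assn (G ⊚ F) N ((G ⊚ F) ⊚ L) ∘ (whr1 Psi' ((G ⊚ F) ⊚ L) ∘ Phi'))) ≅
  whr (whlc (G ⊚ F) Upsilon' ∘ (assn (G ⊚ F) N (G ⊚ F) ∘ whr1 Psi' (G ⊚ F))) L
    ∘ Phi' :=
  (whl (G ⊚ F) (whrc Upsilon' L) ◂ whl (G ⊚ F) (assni N (G ⊚ F) L) ◂
     assn (G ⊚ F) N ((G ⊚ F) ⊚ L) ◂
     at12 (iso_sym (assn_nat1_1 Psi' (G ⊚ F) L)) Phi')
  ⊙ (whl (G ⊚ F) (whrc Upsilon' L) ◂
       at32 (pent_r (G ⊚ F) N (G ⊚ F) L) (whr (whr1 Psi' (G ⊚ F)) L ∘ Phi'))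
  ⊙ at21 (iso_sym (assn_nat2_c (G ⊚ F) Upsilon' L))
      (whr (assn (G ⊚ F) N (G ⊚ F)) L ∘ (whr (whr1 Psi' (G ⊚ F)) L ∘ Phi'))
  ⊙ (whr (whlc (G ⊚ F) Upsilon') L ◂
       at21 (whr_comp (assn (G ⊚ F) N (G ⊚ F)) (whr1 Psi' (G ⊚ F)) L) Phi')
  ⊙ at21 (whr_comp (whlc (G ⊚ F) Upsilon')
            (assn (G ⊚ F) N (G ⊚ F) ∘ whr1 Psi' (G ⊚ F)) L) Phi'.

Definition phi2'' :
  whl G Theta' ∘ (assn G (F ⊚ N) G ∘ whr1 Psi'' G) ≅ whl1 G Φ :=
  phi2''_expand
  ⊙ (assn G F L ◂
       (phi2''_exch ⊙ phi2''_collect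
        ⊙ ((whr_iso right_triangle' L ⊙ whr_id (G ⊚ F) L) ▸ Phi')
        ⊙ iso_lun Phi'))
  ⊙ at21 (assn_assni G F L) (whl1 G Φ)
  ⊙ iso_lun (whl1 G Φ).

Definition phi2_a :
  whl ((F ⊚ N) ⊚ G) Theta' ∘ (assn ((F ⊚ N) ⊚ G) (F ⊚ N) G ∘ whr Xi' G) ≅
  whl1 ((F ⊚ N) ⊚ G) Φ :=
  (whl ((F ⊚ N) ⊚ G) Theta' ◂ assn ((F ⊚ N) ⊚ G) (F ⊚ N) G ◂
     (iso_sym (whr_comp (assni (F ⊚ N) G (F ⊚ N)) (whl1 (F ⊚ N) Psi'') G)
      ⊙ (whr (assni (F ⊚ N) G (F ⊚ N)) G ◂
           iso_sym (assni_nat2_1 (F ⊚ N) Psi'' G))))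
  ⊙ (whl ((F ⊚ N) ⊚ G) Theta' ◂
       at32 (pent_i (F ⊚ N) G (F ⊚ N) G) (whl (F ⊚ N) (whr1 Psi'' G)))
  ⊙ at22 (iso_sym (assni_nat3 (F ⊚ N) G Theta'))
      (whl (F ⊚ N) (assn G (F ⊚ N) G) ∘ whl (F ⊚ N) (whr1 Psi'' G))
  ⊙ (assni (F ⊚ N) G (F ⊚ L) ◂
       ((whl (F ⊚ N) (whl G Theta') ◂
           whl_comp (F ⊚ N) (assn G (F ⊚ N) G) (whr1 Psi'' G))
        ⊙ whl_comp (F ⊚ N) (whl G Theta') (assn G (F ⊚ N) G ∘ whr1 Psi'' G)
        ⊙ whl_iso (F ⊚ N) phi2''))
  ⊙ assni_nat3_1 (F ⊚ N) G Φ.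

Definition phi1 :
  Theta'' ∘ whr (whr1 Φ (F ⊚ N)) G ≅ whr1 Φ (F ⊚ L) ∘ Theta' :=
  iso_asc (whl (F ⊚ L) Theta') (assn (F ⊚ L) (F ⊚ N) G) _
  ⊙ (whl (F ⊚ L) Theta' ◂ assn_nat1_1 Φ (F ⊚ N) G)
  ⊙ exch_1l Φ Theta'.

Definition phi2 : Theta'' ∘ whr Xi G ≅ whl1 (F ⊚ L) Φ ∘ Theta' :=
  (Theta'' ◂ iso_sym (whr_comp (whr Theta' (F ⊚ N)) Xi' G))
  ⊙ iso_asc (whl (F ⊚ L) Theta') (assn (F ⊚ L) (F ⊚ N) G) _
  ⊙ (whl (F ⊚ L) Theta' ◂ at22 (assn_nat1 Theta' (F ⊚ N) G) (whr Xi' G))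
  ⊙ at22 (exch Theta' Theta') (assn ((F ⊚ N) ⊚ G) (F ⊚ N) G ∘ whr Xi' G)
  ⊙ (whr Theta' (F ⊚ L) ◂ phi2_a)
  ⊙ iso_sym (exch_s1 Theta' Φ).

End Construction.

(* Main.v *)
Require Import Defs.
From Stdlib Require Import ssreflect.

(* The unit η with GΛ ∘ η ≅ Ψ'' is the factorisation of Ψ'' through the inverter
   of Gμ.  Whiskering the equation relating μ and ν with Λ_G shows that
   Θ' ∘ Λ_G is an inverter cone of ν, and the counit ε with Φ ∘ ε ≅ Θ' ∘ Λ_G is
   its factorisation through Φ.  Both triangles then only require isomorphisms
   of 1-cells, since GΦ, Φ_FN and Λ can be cancelled on the left: after
   composition with GΦ, the right triangle becomes
   GΘ' ∘ Ψ''_G ≅ GΦ, and after composition with Φ_FN ∘ Λ, the left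
   one becomes Ξ ∘ Λ ≅ Φ_FN ∘ Λ, which is μ * Λ. *)

Set Implicit Arguments.
Unset Strict Implicit.
Unset Printing Implicit Defensive.

(** * Invertible 2-cells, and cancelling fully faithful 1-cells and inverters *)

Section Cancellation.
Context (D : Bicat).
Implicit Types w x y : D.

Lemma invertible_iso2 x y (f g : Hom x y) (a : Cell f g) :
  invertible a -> inhabited (f ≅ g).
Proof. by case=> b [ba ab]; split; exists a b. Qed.

Lemma invertible_fwd x y (f g : Hom x y) (i : f ≅ g) : invertible (fwd i).
Proof. by exists (bwd i); rewrite bwd_fwd fwd_bwd. Qed.

Lemma invertible_vcomp x y (f g h : Hom x y) (b : Cell g h) (a : Cell f g) :
  invertible b -> invertible a -> invertible (b • a).
Proof.
move=> [b' [hb hb']] [a' [ha ha']].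
exact: (invertible_fwd (iso_trans (Iso2 ha ha') (Iso2 hb hb'))).
Qed.

Lemma invertible_lwh x y z (g : Hom y z) (f f' : Hom x y) (a : Cell f f') :
  invertible a -> invertible (g ◁ a).
Proof. move=> [a' [ha ha']]; exact: (invertible_fwd (g ◂ Iso2 ha ha')). Qed.

Lemma invertible_rwh x y z (g g' : Hom y z) (b : Cell g g') (f : Hom x y) :
  invertible b -> invertible (b ▷ f).
Proof. move=> [b' [hb hb']]; exact: (invertible_fwd (Iso2 hb hb' ▸ f)). Qed.

(** Carries invertibility across a square with two invertible sides, such as an associator
    naturality square or the equation relating [μ] and [ν]. *)
Lemma invertible_conj x y (f f' g g' : Hom x y) (i : f ≅ f') (j : g ≅ g')
  (a : Cell f g) (b : Cell f' g') :
  fwd j • a = b • fwd i -> invertible a <-> invertible b.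
Proof.
move=> e; split=> h.
- rewrite (move_bwd_r (i := i) (eq_sym e)).
  apply: invertible_vcomp (invertible_fwd (iso_sym i)).
  exact: invertible_vcomp (invertible_fwd j) h.
- rewrite (move_bwd_l (i := j) e).
  apply: invertible_vcomp (invertible_fwd (iso_sym j)) _.
  exact: invertible_vcomp h (invertible_fwd i).
Qed.

(** Fullness lifts both directions of the isomorphism; the lifts are mutually inverse because an
    identity has only one preimage. *)
Lemma fully_faithful1_cancel w x y (f : Hom x y) (a b : Hom w x) :
  fully_faithful1 f -> f ∘ a ≅ f ∘ b -> inhabited (a ≅ b).
Proof.
move=> ff i.
have [u [fu _]] := ff w a b (fwd i).
have [v [fv _]] := ff w b a (bwd i).
rewrite /= in u v fu fv.
split; exists u v.
- have [t [_ uniq]] := ff w a a (id2 (f ∘ a)).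
  transitivity t; [symmetry|]; apply: uniq => /=; last exact: lwh_id.
  by rewrite lwh_comp fu fv bwd_fwd.
- have [t [_ uniq]] := ff w b b (id2 (f ∘ b)).
  transitivity t; [symmetry|]; apply: uniq => /=; last exact: lwh_id.
  by rewrite lwh_comp fu fv fwd_bwd.
Qed.

Context (x1 x2 : D) (f1 f2 : Hom x1 x2) (phi : Cell f1 f2).

(** Essential surjectivity of the equivalence onto cones: [u] is the value of a quasi-inverse at the
    cone [g]. *)
Lemma inverter_factor x0 (f0 : Hom x0 x1) w (g : Hom w x1) :
  is_inverter phi f0 -> is_inverter_cone phi g ->
  exists u : Hom w x0, inhabited (f0 ∘ u ≅ g).
Proof.
move=> [h eq] cone; have [K [_ [e]]] := eq w.
pose X : InvCone phi w := exist _ g cone.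
exists (K X); split.
exact: (@Iso2 D _ _ (f0 ∘ K X) g (ni e X) (ni_inv e X)
  (ni_inv_l e X) (ni_inv_r e X)).
Qed.

(** Cones form a full subcategory, so [i] is an isomorphism of cones; a quasi-inverse [K] maps it to
    one that is conjugated back along [K (T c) ≅ c]. *)
Lemma inverter_cancel x0 (f0 : Hom x0 x1) w (a b : Hom w x0) :
  is_inverter phi f0 -> f0 ∘ a ≅ f0 ∘ b -> inhabited (a ≅ b).
Proof.
move=> [h eq] i; have [K [[e] _]] := eq w.
pose T := to_InvCone h w; split.
have j (c : Hom w x0) : K (T c) ≅ c :=
  @Iso2 D _ _ (K (T c)) c (ni e c) (ni_inv e c) (ni_inv_l e c) (ni_inv_r e c).
apply: iso_trans (iso_sym (j a)) _; apply: iso_trans (j b).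
exists (@fhom _ _ K (T a) (T b) (fwd i)) (@fhom _ _ K (T b) (T a) (bwd i)).
- have := fhom_comp K (x := T a) (y := T b) (z := T a) (bwd i) (fwd i).
  by rewrite /= bwd_fwd => <-; exact: (fhom_id K (T a)).
- have := fhom_comp K (x := T b) (y := T a) (z := T b) (fwd i) (bwd i).
  by rewrite /= fwd_bwd => <-; exact: (fhom_id K (T b)).
Qed.

End Cancellation.

(** * Whiskering isomorphisms, with unitors suppressed, and further naturalities of the
    associator *)

Definition whl1_c_comp (A B : Bicat) (G : Psfun A B) (K K' : Psfun A A)
  (t : PsNat (psid A) K') (s : PsNat K (psid A)) :
  whl1 G t ∘ whlc G s ≅ whl G (t ∘ s) :=
  @iso_mod A B _ _ (whl1 G t ∘ whlc G s) (whl G (t ∘ s))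
    (fun x => fcomp (pss G) (t x) (s x)) (whl_comp_law G t s).

Definition whl1_comp (A B : Bicat) (G : Psfun A B) (K K' : Psfun A A)
  (t : PsNat K K') (s : PsNat (psid A) K) : whl G t ∘ whl1 G s ≅ whl1 G (t ∘ s) :=
  @iso_mod A B _ _ (whl G t ∘ whl1 G s) (whl1 G (t ∘ s))
    (fun x => fcomp (pss G) (t x) (s x)) (whl_comp_law G t s).

Definition whr1_c_comp (A B : Bicat) (K K' : Psfun B B) (t : PsNat (psid B) K')
  (s : PsNat K (psid B)) (F : Psfun A B) :
  whr1 t F ∘ whrc s F ≅ whr (t ∘ s) F.
Proof.
refine (@iso_mod A B _ _ (whr1 t F ∘ whrc s F) (whr (t ∘ s) F)
  (fun x => iso_refl (t (F x) ∘ s (F x))) _).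
abstract (by same_cells).
Defined.

(** The modification axiom does not mention the comparison cells of the pseudofunctors, so the
    components of [i] serve unchanged. *)
Definition recast_iso (A B : Bicat) (D D' : PsData A B) (P P' : PsStr D)
  (Q Q' : PsStr D') (a : agree P P') (b : agree Q Q')
  (s t : PsNat (mkPsfun P) (mkPsfun Q)) (i : s ≅ t) :
  recast a b s ≅ recast a b t.
Proof.
refine (@iso_mod A B _ _ (recast a b s) (recast a b t)
  (fun x => @Iso2 B _ _ (s x) (t x) (mc (fwd i) x) (mc (bwd i) x) _ _)
  (mc_nat (fwd i))).
- abstract (exact: (f_equal (fun m : Mod s s => m x) (bwd_fwd i))).
- abstract (exact: (f_equal (fun m : Mod t t => m x) (fwd_bwd i))).
Defined.

Definition whl1_iso (A B : Bicat) (G : Psfun A B) (K : Psfun A A)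
  (s t : PsNat (psid A) K) (i : s ≅ t) : whl1 G s ≅ whl1 G t :=
  recast_iso (agree_1r G) (agree_refl _) (whl_iso G i).

Definition whr1_iso (A B : Bicat) (K : Psfun B B) (s t : PsNat (psid B) K)
  (i : s ≅ t) (F : Psfun A B) : whr1 s F ≅ whr1 t F :=
  recast_iso (agree_1l F) (agree_refl _) (whr_iso i F).

Definition assn_nat2 (A B C E : Bicat) (H : Psfun C E) (G G' : Psfun B C)
  (s : PsNat G G') (F : Psfun A B) :
  assn H G' F ∘ whr (whl H s) F ≅ whl H (whr s F) ∘ assn H G F.
Proof.
refine (@icon_sq A E _ _ _ _ _ _ (agree_assoc H G F) (agree_assoc H G' F)
  (whr (whl H s) F) (whl H (whr s F)) (fun x => iso_refl (f1 H (s (F x)))) _).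
abstract (by same_cells).
Defined.

Definition assni_nat1 (A B C E : Bicat) (K K' : Psfun C E) (s : PsNat K K')
  (G : Psfun B C) (F : Psfun A B) :
  assni K' G F ∘ whr s (G ⊚ F) ≅ whr (whr s G) F ∘ assni K G F.
Proof.
refine (@icon_sq A E _ _ _ _ _ _ (agree_sym (agree_assoc K G F))
  (agree_sym (agree_assoc K' G F))
  (whr s (G ⊚ F)) (whr (whr s G) F) (fun x => iso_refl (s (G (F x)))) _).
abstract (by same_cells).
Defined.

Lemma invertible_whrm (A B C : Bicat) (G G' : Psfun B C) (s t : PsNat G G')
  (m : Mod s t) (F : Psfun A B) : invertible m -> invertible (whrm m F).
Proof. move=> [m' [h h']]; exact: (invertible_fwd (whr_iso (Iso2 h h') F)). Qed.

(** * The inverter cone that defines the counit *)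

Section Construction.
Context (A B C : Bicat) (F : Psfun A B) (G : Psfun B C) (H : Psfun A C).
Context (Γ : @equivalence (PsBicat A C) (G ⊚ F) H).
Context (L : Psfun B A) (Φ : PsNat (psid B) (F ⊚ L)).
Context (N : Psfun C A) (NH : biadjunction N H).
Context (M : Psfun C B) (Λ : PsNat M (F ⊚ N)).

Local Notation FN := (F ⊚ N).
Local Notation FL := (F ⊚ L).
Local Notation θ' := (Theta' Γ Φ NH).
Local Notation ψ'' := (Psi'' Γ NH).

Lemma is_inverter_cone_counit (μ : Mod (whr1 Φ FN) (Xi Γ Φ NH))
  (ν : Mod (whr1 Φ FL) (whl1 FL Φ)) :
  fwd (phi2 Γ Φ NH) • (Theta'' Γ Φ NH ◁ whrm μ G) =
    (ν ▷ θ') • fwd (phi1 Γ Φ NH) ->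
  is_inverter_cone μ Λ -> is_inverter_cone ν (θ' ∘ whr Λ G).
Proof.
rewrite /is_inverter_cone => compat cone.
apply/(invertible_conj (i := iso_asc _ _ _) (j := iso_asc _ _ _)
  (asc_nat_l ν θ' (whr Λ G))).
(* [compat] whiskered with [whr Λ G] trades [ν] for [μ], since [phi1] and [phi2] are invertible. *)
apply/(invertible_conj (i := phi1 Γ Φ NH ▸ whr Λ G)
  (j := phi2 Γ Φ NH ▸ whr Λ G) (a := (Theta'' Γ Φ NH ◁ whrm μ G) ▷ whr Λ G)).
  have e := f_equal (fun c => c ▷ whr Λ G) compat.
  by rewrite (rwh_comp _ (fwd _)) (rwh_comp _ _ (fwd _)) in e.
apply/(invertible_conj (i := iso_asc _ _ _) (j := iso_asc _ _ _)
  (asc_nat_m (Theta'' Γ Φ NH) (whrm μ G) (whr Λ G))).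
apply: invertible_lwh.
(* Restriction along [G] commutes with whiskering by [Λ], so only the invertibility of [μ ▷ Λ]
   remains. *)
apply/(invertible_conj (i := whr_comp _ Λ G) (j := whr_comp _ Λ G)
  (b := whrm (μ ▷ Λ) G)); last exact: invertible_whrm.
by apply: Mod_eq => x /=; rewrite vidl vidr.
Qed.

(** * The two triangles, composed with the 1-cells to be cancelled *)

Section Triangles.
Context (η : PsNat (psid C) (G ⊚ M)) (ε : PsNat (M ⊚ G) (psid B)).
Context (iη : whl G Λ ∘ η ≅ ψ'') (iε : Φ ∘ ε ≅ θ' ∘ whr Λ G).

Definition right_triangle_GPhi :
  whl1 G Φ ∘ (whlc G ε ∘ (assn G M G ∘ whr1 η G)) ≅ whl1 G Φ ∘ id1 G :=
  at21 (whl1_c_comp G Φ ε) (assn G M G ∘ whr1 η G)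
  ⊙ ((whl_iso G iε ⊙ iso_sym (whl_comp G θ' (whr Λ G))) ▸ _)
  ⊙ iso_asc (whl G θ') (whl G (whr Λ G)) _
  ⊙ (whl G θ' ◂ at22 (iso_sym (assn_nat2 G Λ G)) (whr1 η G))
  ⊙ (whl G θ' ◂ assn G FN G ◂ (whr1_comp (whl G Λ) η G ⊙ whr1_iso iη G))
  (* The right triangle of N ⊣ H enters here, through [phi2'']. *)
  ⊙ phi2'' Γ Φ NH
  ⊙ iso_sym (iso_run (whl1 G Φ)).

Definition left_triangle_PhiLambda (k : whr1 Φ FN ∘ Λ ≅ Xi Γ Φ NH ∘ Λ) :
  whr1 Φ FN ∘ (Λ ∘ (whrc ε M ∘ (assni M G M ∘ whl1 M η))) ≅
  whr1 Φ FN ∘ (Λ ∘ id1 M) :=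
  at22 (iso_sym (exch_1l Φ Λ)) _
  ⊙ (whl FL Λ ◂ at21 (whr1_c_comp Φ ε M ⊙ whr_iso iε M
       ⊙ iso_sym (whr_comp θ' (whr Λ G) M)) (assni M G M ∘ whl1 M η))
  ⊙ (whl FL Λ ◂ iso_asc (whr θ' M) (whr (whr Λ G) M) _)
  ⊙ at22 (exch θ' Λ) (whr (whr Λ G) M ∘ (assni M G M ∘ whl1 M η))
  ⊙ (whr θ' FN ◂ whl (FN ⊚ G) Λ ◂
       at22 (iso_sym (assni_nat1 Λ G M)) (whl1 M η))
  ⊙ (whr θ' FN ◂ at22 (iso_sym (assni_nat3 FN G Λ)) (whr Λ (G ⊚ M) ∘ whl1 M η))
  (* Exchanging [Λ] with [η] brings [whl G Λ] next to [η] under [FN], so that [iη] applies and [Xi]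
     can be reassembled. *)
  ⊙ (whr θ' FN ◂ assni FN G FN ◂ whl FN (whl G Λ) ◂ iso_sym (exch_s1 Λ η))
  ⊙ (whr θ' FN ◂ assni FN G FN ◂
       at21 (whl1_comp FN (whl G Λ) η ⊙ whl1_iso FN iη) Λ)
  ⊙ (whr θ' FN ◂ iso_sym (iso_asc (assni FN G FN) (whl1 FN ψ'') Λ))
  ⊙ iso_sym (iso_asc (whr θ' FN) (Xi' Γ NH) Λ)
  ⊙ iso_sym k
  ⊙ (whr1 Φ FN ◂ iso_sym (iso_run Λ)).

End Triangles.
End Construction.

Theorem theorem1 (A B C : Bicat)
  (F : Psfun A B) (G : Psfun B C) (H : Psfun A C)
  (Γ : @equivalence (PsBicat A C) (G ⊚ F) H)
  (L : Psfun B A) (LF : biadjunction L F)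
  (N : Psfun C A) (NH : biadjunction N H)
  (M : Psfun C B) (Λ : PsNat M (F ⊚ N))
  (μ : Mod (whr1 (bi_unit LF) (F ⊚ N)) (Xi Γ (bi_unit LF) NH))
  (ν : Mod (whr1 (bi_unit LF) (F ⊚ L)) (whl1 (F ⊚ L) (bi_unit LF)))
  (inverter_μ : @is_inverter (PsBicat C B) _ _ _ _ μ M Λ)
  (inverter_Gμ :
    @is_inverter (PsBicat C C) _ _ _ _ (whlm G μ) (G ⊚ M) (whl G Λ))
  (invertible_GμΨ'' : invertible (whlm G μ ▷ Psi'' Γ NH))
  (inverter_ν : @is_inverter (PsBicat B B) _ _ _ _ ν (psid B) (bi_unit LF))
  (compat_μν :
    fwd (phi2 Γ (bi_unit LF) NH) •
      (Theta'' Γ (bi_unit LF) NH ◁ whrm μ G) =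
    (ν ▷ Theta' Γ (bi_unit LF) NH) • fwd (phi1 Γ (bi_unit LF) NH))
  (ff_GΦ : @fully_faithful1 (PsBicat B C) _ _ (whl1 G (bi_unit LF)))
  (ff_ΦFN : @fully_faithful1 (PsBicat C B) _ _ (whr1 (bi_unit LF) (F ⊚ N))) :
  is_left_biadjoint M G.
Proof.
(* [invertible_GμΨ''] says exactly that Ψ'' is an inverter cone of [whlm G μ]. *)
have [η [iη]] := inverter_factor inverter_Gμ invertible_GμΨ''.
have [cone_Λ _] := inverter_μ.
have [ε [iε]] :=
  inverter_factor inverter_ν (is_inverter_cone_counit compat_μν cone_Λ).
have [k] := invertible_iso2 cone_Λ.
have [right] := fully_faithful1_cancel ff_GΦ (right_triangle_GPhi iη iε).
have [left'] := fully_faithful1_cancel ff_ΦFN (left_triangle_PhiLambda iη iε k).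
have [left] := inverter_cancel inverter_μ left'.
by split; exists η ε.
Qed.
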